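(* Let $\Omega\subset\mathbb{R}^n$, $\Gamma$, $\Omega^\pm$, $\beta$ and the unit normal $\mathbf{n}$ be as in the context. If $f\in L^2(\Omega)$, $g\in H^1(\Omega)$ and $a,b\in H^1_0(\Omega)$, then there exists a unique $u\in H(a,g)=\{u: u-g+a\chi_{\Omega^-}\in H^1_0(\Omega)\}$ such that $v=u-g+a\chi_{\Omega^-}$ satisfies $$-\int_\Omega\beta\nabla v\cdot\nabla\psi=\int_\Omega f\psi+\int_\Omega\beta\nabla g\cdot\nabla\psi-\int_{\Omega^-}\beta\nabla a\cdot\nabla\psi+\int_{\Omega^-}\nabla\cdot(b\psi\,\mathbf{n})$$ for all $\psi\in H^1_0(\Omega)$. (That is, there is a unique weak solution in $H(a,g)$ of the interface problem $\nabla\cdot(\beta\nabla u)=f$ in $\Omega\setminus\Gamma$, $[u]_\Gamma=a$ and $[\mathbf{n}\cdot\beta\nabla u]_\Gamma=b$ on $\Gamma$, $u=g$ on $\partial\Omega$.)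
   Context: $\Omega\subset\mathbb{R}^n$ is a bounded domain with smooth boundary. $\Gamma\subset\Omega$ is a smooth hypersurface, the zero level set of a smooth function $\phi$ which near $\Gamma$ is the signed distance function to $\Gamma$. $\Omega^-=\{\phi<0\}$, $\Omega^+=\{\phi>0\}$, $\partial\Omega^-=\Gamma$, $\Omega=\Omega^+\cup\Omega^-\cup\Gamma$ (disjoint union). $\mathbf{n}=\nabla\phi/|\nabla\phi|$ on $\Gamma$ is the unit normal pointing from $\Omega^-$ to $\Omega^+$; in volume integrals over $\Omega^-$, $\mathbf{n}$ denotes a $C^1$ extension of this normal field to $\overline{\Omega^-}$ (the value of the integral $\int_{\Omega^-}\nabla\cdot(b\psi\,\mathbf{n})=\int_\Gamma b\psi\,ds$ does not depend on the extension). $\beta(x)$ is a symmetric positive definite $n\times n$ matrix whose entries are $C^1$ on the closure of each of $\Omega^-$ and $\Omega^+$ (possibly discontinuous across $\Gamma$, where $\beta$ takes the limiting values from $\Omega^-$), with $m\,\mathrm{Id}\le\beta(x)\le M\,\mathrm{Id}$ for constants $0<m<M$. $\chi_{\Omega^-}$ is the characteristic function of $\Omega^-$. $[w]_\Gamma=w^+-w^-$ is the jump across $\Gamma$, with $w^\pm$ the limits from $\Omega^\pm$. *)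

(* Defs.v *)
From HB Require Import structures.
From mathcomp Require Import all_boot all_order all_algebra.
From mathcomp Require Import all_classical all_reals all_analysis.

Set Implicit Arguments.
Unset Strict Implicit.
Unset Printing Implicit Defensive.

Import Order.TTheory GRing.Theory Num.Theory.
Import numFieldNormedType.Exports.

Local Open Scope classical_set_scope.
Local Open Scope ring_scope.

(* R^n is 'rV[R]_n, with the topology of the library. Its sigma-algebra is the
   one generated by the coordinates, as for n.-tuple in the library; it is the
   Borel sigma-algebra. *)
Definition rV_display : measure_display.
Proof. exact: default_measure_display. Qed.

Definition rV_coord (R : realType) (n : nat) (i : 'I_n) (x : 'rV[R]_n) :
  measurableTypeR R := x ord0 i.

Section measurable_rV.
Context {R : realType} (n : nat).

Let rV_set0 : g_sigma_preimage (@rV_coord R n) set0.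
Proof. exact: sigma_algebra0. Qed.

Let rV_setC A : g_sigma_preimage (@rV_coord R n) A ->
  g_sigma_preimage (@rV_coord R n) (~` A).
Proof. exact: sigma_algebraC. Qed.

Let rV_bigcup (F : (set 'rV[R]_n)^nat) :
  (forall i, g_sigma_preimage (@rV_coord R n) (F i)) ->
  g_sigma_preimage (@rV_coord R n) (\bigcup_i (F i)).
Proof. exact: sigma_algebra_bigcup. Qed.

HB.instance Definition _ := @isMeasurable.Build rV_display
  'rV[R]_n (g_sigma_preimage (@rV_coord R n)) rV_set0 rV_setC rV_bigcup.

End measurable_rV.

Lemma measurable_rV_coord (R : realType) (n : nat) (i : 'I_n) :
  measurable_fun [set: 'rV[R]_n] (@rV_coord R n i).
Proof.
move=> _ Y mY; rewrite setTI; apply: sub_sigma_algebra => /=.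
rewrite -bigcup_seq/=; exists i => /=; first by rewrite mem_index_enum.
by exists Y => //; rewrite setTI.
Qed.

Lemma measurable_fun_rVP (d : measure_display) (T : measurableType d)
    (R : realType) (n : nat) (f : T -> 'rV[R]_n) :
  (forall i, measurable_fun [set: T] (@rV_coord R n i \o f)) ->
  measurable_fun [set: T] f.
Proof.
move=> mf; apply: (@measurability _ _ _ _ _ _
  (\big[setU/set0]_(i < n) preimage_set_system setT (@rV_coord R n i)
    measurable)) => //.
move=> _ [B + <-]; rewrite -bigcup_seq => -[i _ [C mC <-]].
by rewrite setTI -comp_preimage; exact: mf.
Qed.

Definition rV_cons (R : realType) (n : nat)
    (p : measurableTypeR R * 'rV[R]_n) : 'rV[R]_n.+1 :=
  \row_i (if unlift ord0 i is Some j then p.2 ord0 j else p.1).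

Definition rV_behead (R : realType) (n : nat) (x : 'rV[R]_n.+1) : 'rV[R]_n :=
  \row_i x ord0 (lift ord0 i).

Lemma measurable_rV_cons (R : realType) (n : nat) :
  measurable_fun setT (@rV_cons R n).
Proof.
apply: measurable_fun_rVP => i; case: (unliftP ord0 i) => [j|] ->.
- rewrite (_ : _ \o _ = @rV_coord R n j \o snd).
    by apply: measurableT_comp => //; exact: measurable_rV_coord.
  by apply/funext => p; rewrite /= /rV_coord mxE liftK.
- rewrite (_ : _ \o _ = fst); first exact: measurable_fst.
  by apply/funext => p; rewrite /= /rV_coord mxE unlift_none.
Qed.

Lemma measurable_rV_behead (R : realType) (n : nat) :
  measurable_fun setT (@rV_behead R n).
Proof.
apply: measurable_fun_rVP => i.
rewrite (_ : _ \o _ = @rV_coord R n.+1 (lift ord0 i)).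
  exact: measurable_rV_coord.
by apply/funext => x; rewrite /= /rV_coord mxE.
Qed.

Section lebesgue_rV_step.
Context {R : realType} (n : nat).
Variable mu : {sigma_finite_measure set 'rV[R]_n -> \bar R}.
Local Open Scope ereal_scope.

Definition lebesgue_rV_step : set 'rV[R]_n.+1 -> \bar R :=
  pushforward ((@lebesgue_measure R) \x mu) (@rV_cons R n).

Let mcons := @measurable_rV_cons R n.

Let step0 : lebesgue_rV_step set0 = 0.
Proof. exact: measure0. Qed.

Let step_ge0 A : 0 <= lebesgue_rV_step A.
Proof. exact: measure_ge0. Qed.

Let step_sigma_additive : semi_sigma_additive lebesgue_rV_step.
Proof. exact: measure_semi_sigma_additive. Qed.

HB.instance Definition _ := isMeasure.Build _ _ _ lebesgue_rV_step
  step0 step_ge0 step_sigma_additive.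

Let step_sigma_finite : sigma_finite setT lebesgue_rV_step.
Proof.
have /sigma_finiteP[F [TF ndF Foo]] := sigma_finiteT (@lebesgue_measure R).
have /sigma_finiteP[G [TG ndG Goo]] := sigma_finiteT mu.
pose split (x : 'rV[R]_n.+1) : measurableTypeR R * 'rV[R]_n :=
  (@rV_coord R n.+1 ord0 x, rV_behead x).
have msplit : measurable_fun setT split.
  apply/measurable_fun_pairP; split.
    exact: measurable_rV_coord.
  exact: measurable_rV_behead.
have consK : cancel (@rV_cons R n) split.
  move=> [t y]; rewrite /split /rV_coord mxE unlift_none; congr pair.
  by apply/rowP => j; rewrite !mxE liftK.
exists (fun k => split @^-1` (F k `*` G k)).
  rewrite -preimage_bigcup -(preimage_setT split); congr (_ @^-1` _).
  rewrite -setXTT TF TG predeqE => -[x y]; split.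
    move=> [/= [p _ Fpx] [k _ Gky]]; exists (maxn p k) => //; split.
    - by move: x Fpx; exact/subsetPset/ndF/leq_maxl.
    - by move: y Gky; exact/subsetPset/ndG/leq_maxr.
  by move=> [p _ []/= ? ?]; split; exists p.
move=> k; have [mF Fk] := Foo k; have [mG Gk] := Goo k; split.
  by rewrite -[X in measurable X]setTI; apply: msplit => //; exact: measurableX.
rewrite /lebesgue_rV_step /pushforward -comp_preimage.
rewrite (_ : _ \o _ = id); last by apply/funext => p /=; rewrite consK.
by rewrite preimage_id product_measure1E// lte_mul_pinfty// ge0_fin_numE.
Qed.

HB.instance Definition _ := Measure_isSigmaFinite.Build _ _ _ lebesgue_rV_step
  step_sigma_finite.

End lebesgue_rV_step.

Fixpoint lebesgue_rV (R : realType) (n : nat) :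
    {sigma_finite_measure set 'rV[R]_n -> \bar R} :=
  if n is m.+1 then lebesgue_rV_step (lebesgue_rV R m)
  else dirac (0 : 'rV[R]_0).

Lemma lebesgue_rV_box (R : realType) (n : nat)
    (A : 'I_n -> set (measurableTypeR R)) :
  (forall i, measurable (A i)) ->
  lebesgue_rV R n [set x | forall i, A i (x ord0 i)] =
  (\prod_(i < n) lebesgue_measure (A i))%E.
Proof.
elim: n A => [|n IH] A mA.
  rewrite big_ord0 /= diracE mem_set// => -[].  by [].
rewrite big_ord_recl /=.
rewrite -IH; last by move=> i; exact: mA.
rewrite -product_measure1E//; last first.
  rewrite [X in measurable X](_ : _ = 
      \bigcap_(i in [set: 'I_n]) (@rV_coord R n i @^-1` A (lift ord0 i))).
    apply: fin_bigcap_measurable => // i _.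
    by rewrite -[X in measurable X]setTI; exact: measurable_rV_coord.
  by apply/seteqP; split => x /= H i; [move=> _|]; exact: H.
rewrite /lebesgue_rV_step /pushforward; congr (_ _).
apply/seteqP; split => -[t y] /= H.
  split=> [|i].
    by have := H ord0; rewrite mxE unlift_none.
  by have := H (lift ord0 i); rewrite mxE liftK.
move=> i; rewrite mxE; case: unliftP => [j|] ->; [exact: H.2|exact: H.1].
Qed.

Section sobolev.
Context {R : realType} {n : nat}.
Local Notation Rn := 'rV[R]_n.
Local Notation vol := (lebesgue_rV R n).
Implicit Types (U : set Rn) (f u d : Rn -> R) (x : Rn) (i : 'I_n).

Definition dot (x y : Rn) : R := \sum_i x ord0 i * y ord0 i.

(* The norm of the library on 'rV[R]_n is the maximum norm. *)
Definition enorm x : R := Num.sqrt (dot x x).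

Definition edist x (A : set Rn) : R := inf [set enorm (x - y) | y in A].

Definition mulmxv (B : 'M[R]_n) x : Rn := (B *m x^T)^T.

Definition frontier (A : set Rn) : set Rn := closure A `\` A°.

Definition std_basis i : Rn := delta_mx ord0 i.

Definition partial i f : Rn -> R := 'D_(std_basis i) f.

Definition grad f x : Rn := \row_i partial i f x.

Definition smooth_on U f : Prop :=
  forall (s : seq 'I_n) x, U x ->
    {for x, continuous (foldr partial f s)} /\
    forall i, derivable (foldr partial f s) x (std_basis i).

(* C^1 on the closure of the open set U: f is continuous up to the boundary and
   its first derivatives in U extend continuously to the closure. *)
Definition C1_closure U f : Prop :=
  {within closure U, continuous f} /\
  forall i, (forall x, U x -> derivable f x (std_basis i)) /\
    exists h : Rn -> R, {within closure U, continuous h} /\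
      forall x, U x -> h x = partial i f x.

Definition smooth_boundary U : Prop :=
  forall x0, frontier U x0 -> exists (V : set Rn) (r : Rn -> R),
    [/\ open V, V x0, smooth_on V r &
      forall x, V x -> grad r x != 0 /\ (U x <-> r x < 0)].

Definition test_function U f : Prop :=
  smooth_on setT f /\
  exists K : set Rn, [/\ compact K, K `<=` U & forall x, ~ K x -> f x = 0].

Definition L1loc U f : Prop :=
  forall K : set Rn, compact K -> K `<=` U -> vol.-integrable K (EFin \o f).

Definition L2 U f : Prop := f \_ U \in Lfun vol 2%:E.

Definition weak_partial U i u d : Prop :=
  [/\ L1loc U u, L1loc U d & forall psi, test_function U psi ->
    (\int[vol]_(x in U) (u x * partial i psi x)) =
    - (\int[vol]_(x in U) (d x * psi x))].

(* The weak derivative is unique up to a null set; wpartial picks a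
   representative (and is junk when there is no weak derivative). *)
Definition wpartial U i u : Rn -> R := xget (cst 0) (weak_partial U i u).

Definition wgrad U u x : Rn := \row_i wpartial U i u x.

Definition wdiv U (F : Rn -> Rn) x : R :=
  \sum_i wpartial U i (fun y => F y ord0 i) x.

Definition H1 U u : Prop :=
  L2 U u /\ forall i, exists d, weak_partial U i u d /\ L2 U d.

Definition H1norm U u : R :=
  Num.sqrt (\int[vol]_(x in U) (u x ^+ 2 + dot (wgrad U u x) (wgrad U u x))).

(* H^1_0(U) is the closure of C_c^oo(U) in H^1(U). *)
Definition H10 U u : Prop :=
  H1 U u /\ exists psi : (Rn -> R)^nat,
    (forall k, test_function U (psi k)) /\
    H1norm U (u \- psi k) @[k --> \oo] --> 0.

Definition region_neg U (phi : Rn -> R) : set Rn := U `&` [set x | phi x < 0].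
Definition region_pos U (phi : Rn -> R) : set Rn := U `&` [set x | 0 < phi x].
Definition interface U (phi : Rn -> R) : set Rn := U `&` [set x | phi x = 0].

Definition bounded_smooth_domain U : Prop :=
  [/\ open U, connected U, U !=set0, bounded_set U & smooth_boundary U].

Definition signed_distance_near U (phi : Rn -> R) : Prop :=
  exists V : set Rn, [/\ open V, V `<=` U, interface U phi `<=` V &
    forall x, V x ->
      (0 < phi x -> phi x = edist x (interface U phi)) /\
      (phi x < 0 -> phi x = - edist x (interface U phi))].

(* U is cut by the regular level set {phi = 0}, which is the whole boundary of
   {phi < 0}, and near which phi is the signed distance. *)
Definition level_set_interface U (phi : Rn -> R) : Prop :=
  [/\ smooth_on U phi,
      forall x, interface U phi x -> grad phi x != 0,
      signed_distance_near U phi &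
      frontier (region_neg U phi) = interface U phi].

Definition normal_extension U (phi : Rn -> R) (nu : Rn -> Rn) : Prop :=
  (forall i, C1_closure (region_neg U phi) (fun x => nu x ord0 i)) /\
  forall x, interface U phi x ->
    nu x = (enorm (grad phi x))^-1 *: grad phi x.

(* On the interface, beta takes its limiting values from {phi < 0}. *)
Definition piecewise_C1 U (phi f : Rn -> R) : Prop :=
  C1_closure (region_neg U phi) f /\
  exists h, C1_closure (region_pos U phi) h /\
    forall x, region_pos U phi x -> f x = h x.

(* The Loewner bounds m Id <= beta <= M Id. *)
Definition loewner_bounds U (beta : Rn -> 'M[R]_n) (m M : R) : Prop :=
  forall x, U x -> forall xi : Rn,
    m * dot xi xi <= dot (mulmxv (beta x) xi) xi /\
    dot (mulmxv (beta x) xi) xi <= M * dot xi xi.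

Definition jump_lift U (phi a g u : Rn -> R) : Rn -> R :=
  fun x => u x - g x + a x * \1_(region_neg U phi) x.

Definition Hag U (phi a g u : Rn -> R) : Prop := H10 U (jump_lift U phi a g u).

Definition weak_equation U (phi : Rn -> R) (beta : Rn -> 'M[R]_n)
    (nu : Rn -> Rn) (f g a b v : Rn -> R) : Prop :=
  forall psi : Rn -> R, H10 U psi ->
  - (\int[vol]_(x in U) dot (mulmxv (beta x) (wgrad U v x)) (wgrad U psi x)) =
    (\int[vol]_(x in U) (f x * psi x))
    + (\int[vol]_(x in U) dot (mulmxv (beta x) (wgrad U g x)) (wgrad U psi x))
    - (\int[vol]_(x in region_neg U phi)
         dot (mulmxv (beta x) (wgrad U a x)) (wgrad U psi x))
    + (\int[vol]_(x in region_neg U phi)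
         wdiv (region_neg U phi) (fun y => (b y * psi y) *: nu y) x).

End sobolev.

(* Main.v *)
(* Every term on the right-hand side of the weak equation is a functional
   psi |-> \int F_0 psi + \sum_i \int F_i (d_i psi) with F_0, F_i in L^2(Omega).
   For the term with div(b psi n) this follows from the product rule for
   b psi n_i on Omega^-, where b and psi are only in H^1_0: it is first proved
   for test functions, then extended by density. By the Poincare inequality the
   energy \int beta (grad u) . (grad w) controls the H^1 norm on H^1_0, so the
   quadratic functional attached to the equation is bounded below on test
   functions and its minimizing sequences are Cauchy in H^1; their limit is the
   solution v, and u = v + g - a chi.

   The weak derivative [wpartial] is a choice among all weak derivatives,
   hence the need for their uniqueness: the smooth bumps
   \prod_j exp(- 1 / (k (x_j - l_j) (u_j - x_j))) converge to the indicator of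
   the box (l, u), so a function orthogonal to all test functions has zero
   integral on boxes and vanishes almost everywhere by the pi-lambda theorem. *)

Require Import Defs.
From mathcomp Require Import all_boot all_order all_algebra.
From mathcomp Require Import all_classical all_reals all_analysis.
From mathcomp Require Import measurable_realfun ring lra.

Set Implicit Arguments.
Unset Strict Implicit.
Unset Printing Implicit Defensive.

Import Order.TTheory GRing.Theory Num.Theory.
Import numFieldNormedType.Exports.

Local Open Scope classical_set_scope.
Local Open Scope ring_scope.

(** * Boxes and Borel sets of R^n *)

(** Functions here are plain maps and [wpartial] is linear only almost everywhere, so identities
    between weak derivatives are used under integrals or as a.e. equalities, and uniqueness of the
    solution is meant a.e. The energy is minimized over test functions rather than over H^1_0: the
    limit of the sequence then belongs to H^1_0 by definition, and no completeness of H^1_0 is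
    needed beforehand. The functions and each of their derivatives converge in L^2 separately, and
    the limits are tied together by passing to the limit in the definition of the weak derivative.

    The delicate term is the divergence. The product [b psi] is in general only integrable, so
    approximating it in H^1 is not an option. Instead, for a weight [rho] that is C^1 in direction
    i, the integral of the formal derivative of [b psi rho] is a bounded functional of each factor
    separately; density is applied to one factor at a time. With [rho] the product of a normal
    component and a test function on Omega^-, its vanishing is the weak product rule on Omega^-. *)

Section box.
Context {R : realType} {n : nat}.
Local Notation Rn := 'rV[R]_n.
Local Notation vol := (lebesgue_rV R n).
Implicit Types (l u x y : Rn) (U : set Rn) (f : Rn -> R).

Definition box l u : set Rn :=
  [set x | forall i, l ord0 i < x ord0 i < u ord0 i].
Definition cbox l u : set Rn :=
  [set x | forall i, l ord0 i <= x ord0 i <= u ord0 i].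

Lemma box_cbox l u : box l u `<=` cbox l u.
Proof. by move=> x h i; have /andP[a b] := h i; rewrite !ltW. Qed.

Lemma measurable_box l u : measurable (box l u).
Proof.
rewrite (_ : box l u = \bigcap_(i in [set: 'I_n])
  ((@rV_coord R n i) @^-1` `]l ord0 i, u ord0 i[)); last first.
  apply/seteqP; split => x /= h i; first by move=> _ /=; rewrite in_itv;
    exact: h.
  by have := h i I; rewrite /= in_itv.
apply: fin_bigcap_measurable => // i _.
by rewrite -[X in measurable X]setTI; apply: measurable_rV_coord.
Qed.

Lemma compact_cbox l u : compact (cbox l u).
Proof.
pose A i : set R := `[l ord0 i, u ord0 i]%classic.
rewrite (_ : cbox l u = [set v : Rn | forall i, A i (v ord0 i)]).
  by apply: rV_compact => i; exact: segment_compact.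
by apply/seteqP; split => x /= h i; have := h i; rewrite /A /= in_itv.
Qed.

Lemma ball_rV x e : 0 < e -> forall y : Rn, (forall i,
  `|x ord0 i - y ord0 i| < e) ->
  ball x e y.
Proof. by move=> e0 y h; split => // i j; rewrite ord1; exact: h. Qed.

Lemma open_bigcup_box U : open U -> exists (P : set nat) (l u : nat -> Rn),
  U = \bigcup_(k in P) box (l k) (u k) /\
  forall k, P k -> cbox (l k) (u k) `<=` U.
Proof.
move=> oU.
pose T := ('rV[rat]_n * 'rV[rat]_n)%type.
pose L (p : T) : Rn := map_mx ratr p.1.
pose V (p : T) : Rn := map_mx ratr p.2.
pose P := [set k | exists p : T,
  unpickle k = Some p /\ cbox (L p) (V p) `<=` U].
pose d k : T := odflt (0, 0) (unpickle k).
exists P, (L \o d), (V \o d); split; last first.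
  by move=> k [p [e h]]; rewrite /d /= e.
apply/seteqP; split => [x Ux|x [k [p [e h]] /= +]]; last first.
  by rewrite /d e /= => /box_cbox; exact: h.
have /nbhs_ballP[e /= e0 eU] : nbhs x U by exact: open_nbhs_nbhs.
have [a ha] : {a : 'I_n -> rat & forall i, ratr (a i) \in `]x ord0 i - e,
  x ord0 i[}.
  by apply: (@choice _ _ (fun i q =>
    ratr q \in `]x ord0 i - e, x ord0 i[)) => i; apply: rat_in_itvoo;
      rewrite ltrBlDr ltrDl.
have [b hb] : {b : 'I_n -> rat & forall i, ratr (b i) \in `]x ord0 i,
  x ord0 i + e[}.
  by apply: (@choice _ _ (fun i q =>
    ratr q \in `]x ord0 i, x ord0 i + e[)) => i; apply: rat_in_itvoo;
      rewrite ltrDl.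
pose p : T := (\row_i a i, \row_i b i).
exists (pickle p).
  exists p; split; first by rewrite pickleK.
  move=> y hy; apply: eU; apply: ball_rV => // i.
  have := hy i; rewrite !mxE => /andP[h1 h2].
  have := ha i; have := hb i; rewrite !in_itv /= => /andP[h3 h4] /andP[h5 h6].
  by rewrite ltr_norml; apply/andP; split; lra.
rewrite /d /= pickleK /= => i; rewrite !mxE.
have := ha i; have := hb i; rewrite !in_itv /= => /andP[h3 h4] /andP[h5 h6].
by rewrite h6 h3.
Qed.

Lemma open_measurable_rV U : open U -> measurable U.
Proof.
move=> /open_bigcup_box[P [l [u [-> _]]]].
by apply: bigcup_measurable => k _; exact: measurable_box.
Qed.

Lemma closed_measurable_rV U : closed U -> measurable U.
Proof.
move=> cU; rewrite -[U]setCK; apply: measurableC.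
by apply: open_measurable_rV; exact: closed_openC.
Qed.

Lemma compact_measurable_rV U : compact U -> measurable U.
Proof.
by move=> cU; apply: closed_measurable_rV; exact: compact_closed.
Qed.

Lemma open_continuous_measurable_rV U f : open U ->
  (forall x, U x -> {for x, continuous f}) -> measurable_fun U f.
Proof.
move=> oU cf.
apply: (measurability _ (RGenOInfty.measurableE R)) => //.
move=> _ [_ [c ->] <-].
apply: open_measurable_rV; rewrite openE => x [Ux /=];
  rewrite in_itv /= andbT => fx.
apply: filterI; first by apply: open_nbhs_nbhs.
have := cf x Ux; apply.
have : nbhs (f x) `]c, +oo[%classic.
  by apply: open_nbhs_nbhs; split;
    [exact: interval_open|rewrite /= in_itv /= fx].
by [].
Qed.

Lemma closed_continuous_measurable_rV U f : closed U ->
  {within U, continuous f} -> measurable_fun U f.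
Proof.
move=> cU cf.
apply: (measurability _ (RGenOInfty.measurableE R)) => //.
move=> _ [_ [c ->] <-].
have oI : open (`]c, +oo[%classic : set R) by exact: interval_open.
have /open_subspaceP[V oV VU] := (continuousP _).1 cf _ oI.
rewrite setIC -VU; apply: measurableI; first exact: open_measurable_rV.
exact: closed_measurable_rV.
Qed.

Lemma compact_box K : compact K -> exists l u, K `<=` box l u.
Proof.
move=> /compact_bounded[M [_ h]].
(* Any number above [M] bounds the norm on [K]; [M + 1] is one, and [M + 2] makes the inequalities
   strict. *)
exists (const_mx (- (M + 2))), (const_mx (M + 2)) => x Kx i.
have /= h1 := h (M + 1) (ltr_pwDr ltr01 (lexx _)) x Kx; rewrite !mxE.
have : `|x ord0 i| <= `|x|.
  by rewrite [leRHS]/Num.norm /= mx_normrE; apply/bigmax_geP; right => /=;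
    exists (ord0, i).
by rewrite -ltr_norml => h2; lra.
Qed.

Lemma box_finite_measure l u : (vol (box l u) < +oo)%E.
Proof.
pose A i : set (measurableTypeR R) := `]l ord0 i, u ord0 i[%classic.
rewrite (_ : box l u = [set x | forall i, A i (x ord0 i)]); last first.
  by apply/seteqP; split => x /= h i; have := h i; rewrite /A /= in_itv.
rewrite lebesgue_rV_box; last by move=> i; exact: measurable_itv.
rewrite -ge0_fin_numE; last by apply: prode_ge0 => i _; exact: measure_ge0.
apply: prode_fin_num => i _; rewrite /A lebesgue_measure_itv /=.
by case: ifP => // _; rewrite -EFinB.
Qed.

Lemma compact_finite_vol K : compact K -> (vol K < +oo)%E.
Proof.
move=> /[dup] cK /compact_box[l [u h]].
apply: le_lt_trans (box_finite_measure l u); apply: le_measure h; rewrite inE.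
  exact: compact_measurable_rV.
exact: measurable_box.
Qed.

End box.

(** * The pi-lambda argument on boxes *)

Section box_pi_lambda.
Context {R : realType} {n : nat}.
Local Notation Rn := 'rV[R]_n.
Local Notation vol := (lebesgue_rV R n).
Implicit Types (l u x y : Rn) (A : set Rn) (d : Rn -> R).

Definition boxes : set (set Rn) := [set A | exists l u, A = box l u].

Lemma boxI l u l' u' : box l u `&` box l' u' =
  box (\row_i Num.max (l ord0 i) (l' ord0 i))
      (\row_i Num.min (u ord0 i) (u' ord0 i)).
Proof.
apply/seteqP; split => x /=.
  by move=> [h h'] i; rewrite !mxE gt_max lt_min; have /andP[-> ->] := h i;
    exact: h'.
by move=> h; split => i; have := h i;
  rewrite !mxE gt_max lt_min => /andP[/andP[a b] /andP[c e]]; apply/andP.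
Qed.

Lemma boxes_setI : setI_closed boxes.
Proof. by move=> _ _ [l [u ->]] [l' [u' ->]]; rewrite boxI; do 2 eexists. Qed.

(** It is enough that each coordinate is measurable for the sigma-algebra generated by boxes: the
    half-space [c < x_i] is the union over [k] of the boxes with lower bound [c] in direction [i],
    lower bounds [- k] in the others, and all upper bounds [k]. *)
Lemma measurable_boxes A : measurable A -> <<s boxes >> A.
Proof.
rewrite /measurable /=; apply: smallest_sub;
  first exact: smallest_sigma_algebra.
move=> {}A; rewrite -bigcup_seq => -[i _ [B mB <-]].
have : measurable_fun [set: g_sigma_algebraType boxes]
    ((fun x : g_sigma_algebraType boxes => x ord0 i) : _ -> measurableTypeR R).
  apply: (measurability _ (RGenOInfty.measurableE R)) => //.
  move=> _ [_ [c ->] <-].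
  rewrite (_ : _ `&` _ = \bigcup_k box (\row_j if j == i then c else - k%:R)
      (const_mx k%:R)); last first.
    apply/seteqP; split => x /=.
      move=> [_]; rewrite in_itv /= andbT => cx.
      have [k /= xk] : exists k : nat, `|x| < k%:R.
        by exists (Num.trunc `|x|).+1; rewrite truncnS_gt.
      exists k => // j; rewrite !mxE.
      have : `|x ord0 j| <= `|x|.
        by rewrite [leRHS]/Num.norm /= mx_normrE; apply/bigmax_geP;
          right => /=; exists (ord0, j).
      move=> /le_lt_trans/(_ xk); rewrite ltr_norml => /andP[a ->].
      by case: eqP => [->|_]; rewrite ?cx ?a.
    move=> [k _ /(_ i)]; rewrite !mxE eqxx => /andP[cx _]; split => //.
    by rewrite in_itv /= cx.
  apply: bigcupT_measurable => k; apply: sub_sigma_algebra.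
  by do 2 eexists.
by move=> /(_ measurableT B mB).
Qed.

(** The sets [A] for which [d] has zero integral over the part of [A] in the box form a
    lambda-system, an increasing union being cut into disjoint differences. It contains the boxes,
    which are stable under intersection, hence every measurable set. Only subboxes whose closed box
    is also contained are tested, because that closed box will carry the support of a test
    function. *)
Lemma ae0_of_boxes l u d : vol.-integrable (box l u) (EFin \o d) ->
  (forall l' u', box l' u' `<=` box l u -> cbox l' u' `<=` cbox l u ->
     (\int[vol]_(x in box l' u') (d x)%:E = 0)%E) ->
  ae_eq vol (box l u) d (cst 0).
Proof.
move=> id d0.
have mQ : measurable (box l u) by exact: measurable_box.
pose H := [set A : set Rn | measurable A /\
  (\int[vol]_(x in A `&` box l u) (d x)%:E = 0)%E].
have mI A : measurable A -> measurable (A `&` box l u) by move=> mA;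
  exact: measurableI.
have idS A : measurable A -> vol.-integrable (A `&` box l u) (EFin \o d).
  by move=> mA; apply: integrableS id => //; exact: mI.
have HD A B : B `<=` A -> H A -> H B -> H (A `\` B).
  move=> BA [mA iA] [mB iB].
  have mAB : measurable (A `\` B) by exact: measurableD.
  have E : A `&` box l u = ((A `\` B) `&` box l u) `|` (B `&` box l u).
    by rewrite -setIUl [_ `|` B]setUC setDUK.
  split => //; move: iA; rewrite E integral_setU; [|exact: mI|exact: mI| |].
  - by rewrite iB adde0.
  - by rewrite -E; exact: (measurable_int vol (idS _ mA)).
  - by apply/disj_setPS => x [[[_ nB] _] [Bx _]].
have HP : lambda_system setT H.
  split => //.
  - by split; [exact: measurableT|rewrite setTI; exact: d0].
  - move=> F ndF HF; split; first by apply: bigcupT_measurable => k;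
    have [] := HF k.
    rewrite -eq_bigcup_seqD setI_bigcupl.
    have mS k : measurable (seqD F k).
      by case: k => [|k] /=; [|apply: measurableD]; exact: (HF _).1.
    rewrite integral_bigcup.
    + apply: eseries0 => k _ _; case: k => [|k] /=; first exact: (HF 0%N).2.
      by apply: (HD _ _ _ (HF k.+1) (HF k)).2; apply/subsetPset/ndF.
    + by apply: trivIset_setIr; exact: trivIset_seqD.
    + by move=> k; exact: mI.
    + by rewrite -setI_bigcupl; apply: idS; exact: bigcupT_measurable.
have HB : boxes `<=` H.
  move=> _ [l' [u' ->]]; split; first exact: measurable_box.
  rewrite boxI; apply: d0 => x h i; have := h i; rewrite !mxE.
    by rewrite gt_max lt_min => /andP[/andP[_ ->] /andP[_ ->]].
  by rewrite ge_max le_min => /andP[/andP[_ ->] /andP[_ ->]].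
have HM A : measurable A -> H A.
  move=> /measurable_boxes; apply: (lambda_system_subset boxes_setI HP HB).
  by [].
have : ae_eq vol (box l u) (EFin \o d) (cst 0%E).
  apply: integral_ae_eq => // E EQ mE.
  by rewrite integral0; have [_] := HM _ mE; rewrite setIidl.
by apply: filterS => x /= h Qx; have [] := h Qx.
Qed.

End box_pi_lambda.

(** * Smooth bump functions *)

Section exp_bump.
Context {R : realType}.
Implicit Types (C s t a b : R) (m : nat) (p w : {poly R}).

(** The exponent [m] is a parameter because differentiating [expR (- (C / s))] produces powers of
    [s^-1]; with it, derivatives stay linear combinations of members of the family. *)
Definition expbump C m s : R :=
  if 0 < s then s^-1 ^+ m * expR (- (C * s^-1)) else 0.

Lemma expbumpS C m k s : s ^+ k * expbump C (m + k) s = expbump C m s.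
Proof.
rewrite /expbump; case: ifP => s0; last by rewrite mulr0.
have sn0 : s != 0 by rewrite gt_eqF.
by rewrite exprD mulrA mulrCA -exprMn divff// expr1n mulr1.
Qed.

(** With [y = C / s], the exponential series gives [y ^+ m / m! <= expR y], hence the bound
    [m! / C ^+ m]. The case [m = 0] is settled by the added 1. *)
Lemma expbump_bounded C m : 0 < C -> exists K, forall s, `|expbump C m s| <= K.
Proof.
move=> C0; exists (m`!%:R / C ^+ m + 1) => s; rewrite /expbump.
have K0 : 0 <= m`!%:R / C ^+ m :> R by rewrite divr_ge0// exprn_ge0// ltW.
case: ifP => s0; last by rewrite normr0 addr_ge0.
have i0 : 0 < s^-1 by rewrite invr_gt0.
rewrite ger0_norm; last by rewrite mulr_ge0// ?expR_ge0// exprn_ge0// ltW.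
case: m K0 => [|m] K0.
  rewrite expr0 mul1r; apply: (@le_trans _ _ 1); last by rewrite lerDr.
  by rewrite -expR0 ler_expR oppr_le0 mulr_ge0// ltW.
apply: (@le_trans _ _ (m.+1`!%:R / C ^+ m.+1)); last by rewrite lerDl.
rewrite expRN ler_pdivrMr ?expR_gt0// mulrAC ler_pdivlMr ?exprn_gt0//.
rewrite -exprMn [s^-1 * C]mulrC.
have := @expR_ge1Dxn _ (C * s^-1) m (mulr_ge0 (ltW C0) (ltW i0)).
rewrite -ler_pdivrMl ?ltr0n ?fact_gt0//.
by apply: le_trans; rewrite [leLHS]mulrC lerDr.
Qed.

Lemma is_derive_expbump C m s : 0 < C ->
  is_derive s 1 (expbump C m)
    (C * expbump C (m + 2) s - m%:R * expbump C (m + 1) s).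
Proof.
move=> C0; have [s0|s0|->] := ltgtP s 0.
- rewrite /expbump !ltNge (ltW s0) /= !mulr0 subr0.
  apply: (@near_eq_is_derive _ _ _ (cst 0)).
  near=> y; rewrite ltNge /cst (_ : y <= 0)//; apply: ltW; near: y;
    exact: lt_nbhsl.
- have sn0 : s != 0 by rewrite gt_eqF.
  pose g (y : R) : R := y^-1 ^+ m * expR (- (C * y^-1)).
  apply: (@near_eq_is_derive _ _ _ g).
    by near=> y; rewrite /expbump ifT//; near: y; exact: lt_nbhsr.
  have dV : is_derive s 1 (fun y : R => y^-1) (- s ^- 2 *: 1).
    exact: (@is_deriveV _ id).
  have dN : is_derive s 1 (fun y : R => - (C * y^-1)) (C * s ^- 2).
    have := @is_deriveZ _ _ _ _ (- C) _ _ _ dV.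
    rewrite (_ : _ \*: _ = (fun y => - (C * y^-1))); last first.
      by apply/funext => y; rewrite /= /GRing.scale /= mulNr.
    by move=> h; apply: (is_derive_eq h); rewrite /GRing.scale /= mulr1 mulrNN.
  have dE := @is_derive1_comp _ expR _ s _ _ (is_derive_expR _) dN.
  have dX := @is_deriveX _ _ _ m _ _ _ dV.
  have -> : g = ((fun y : R => y^-1) ^+ m) * (expR \o (fun y : R =>
    - (C * y^-1))).
    by apply/funext => y; rewrite /g !fctE.
  apply: (is_derive_eq (is_deriveM dX dE)).
  rewrite /expbump s0 /GRing.scale /= !mulr1 fctE /=.
  case: m {g dX} => [|m].
    by rewrite !mul0r !mulr0 subr0 expr0 !add0n -!exprVn; ring.
  by rewrite /= addn1 addn2 -!exprVn !exprS; ring.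
- have -> : C * expbump C (m + 2) 0 - m%:R * expbump C (m + 1) 0 = 0.
    by rewrite /expbump ltxx !mulr0 subr0.
  have [K hK] := expbump_bounded (m + 2) C0.
  have K0 : 0 <= K by apply: le_trans (hK 0).
  suff h0 : (fun h : R => h^-1 *: ((expbump C m \o shift 0) (h *: 1) -
      expbump C m 0)) @ 0^' --> (0 : R).
    by apply: DeriveDef; [apply/cvg_ex; exists 0|exact: cvg_lim].
  (* [expbump C m s = s ^+ 2 * expbump C (m + 2) s], the last factor being
     bounded. *)
  apply/cvgrPdist_lt => e e0; near=> h.
  have hn0 : h != 0 by near: h; exact: nbhs_dnbhs_neq.
  have he : `|h| < e / (K + 1).
    by near: h; apply: dnbhs0_lt; rewrite divr_gt0// ltr_wpDl.
  rewrite /= addr0 {2}/expbump ltxx subr0 sub0r normrN.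
  rewrite /GRing.scale /= mulr1 -(expbumpS C m 2) expr2 -mulrA mulKf// normrM.
  move: he; rewrite ltr_pdivlMr ?ltr_wpDl//; apply: le_lt_trans.
  by apply: ler_pM => //; apply: le_trans (hK h) _; rewrite lerDl.
Unshelve. all: by end_near. Qed.

End exp_bump.

Section derive_line.
Context {R : realType} {U V W : normedModType R}.
Implicit Types (f : V -> W) (c : U -> V) (v : V) (t w : U).

(** Both difference quotients coincide, because [c] sends the line through [t] with direction [w] to
    the line through [c t] with direction [v]. This reduces partial derivatives to one variable, and
    passes from a function on R^(n+1) to its slices. *)
Lemma is_derive_line f c v t w (d : W) :
  (forall h, c (h *: w + t) = h *: v + c t) ->
  is_derive t w (f \o c) d <-> is_derive (c t) v f d.
Proof.
move=> ch.
have E : (fun h : R => h^-1 *: ((f \o c \o shift t) (h *: w) - (f \o c) t)) =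
    (fun h => h^-1 *: ((f \o shift (c t)) (h *: v) - f (c t))).
  by apply/funext => h /=; rewrite -ch.
by split=> -[h1 h2]; apply: DeriveDef; move: h1 h2;
  rewrite /derivable /derive E.
Qed.

End derive_line.

Section prodbump.
Context {R : realType} {n : nat}.
Local Notation Rn := 'rV[R]_n.
Implicit Types (x : Rn) (i j : 'I_n) (t : R).

Definition setc x i (t : R) : Rn := \row_j if j == i then t else x ord0 j.

Lemma setc_line x i t h :
  setc x i (h + t) = h *: (std_basis i : Rn) + setc x i t.
Proof.
apply/rowP => j; rewrite !mxE eqxx /=.
by case: eqP => _; rewrite ?mulr1 ?mulr0 ?add0r.
Qed.

Lemma setc_id x i : setc x i (x ord0 i) = x.
Proof. by apply/rowP => j; rewrite mxE; case: eqP => [->|]. Qed.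

Variables (C : R) (w : 'I_n -> {poly R}).
Hypothesis C0 : 0 < C.

Definition polybump (pm : {poly R} * nat) (q : {poly R}) t : R :=
  pm.1.[t] * expbump C pm.2 q.[t].

(** The derivative of [p * expbump C m q] has terms of index [m], [m + 1] and [m + 2]; [expbumpS]
    brings all of them to index [m + 2] at the price of factors [q ^+ 2] and [q], so that it is
    again a single polynomial times a single bump. *)
Definition polybump_deriv (pm : {poly R} * nat) (q : {poly R}) :
    {poly R} * nat :=
  (pm.1^`() * q ^+ 2 + pm.1 * q^`() * (C%:P - pm.2%:R%:P * q), pm.2.+2).

Lemma is_derive_polybump pm q t :
  is_derive t 1 (polybump pm q) (polybump (polybump_deriv pm q) q t).
Proof.
case: pm => p m.
have dE := @is_derive1_comp _ (expbump C m) (horner q) t _ _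
  (is_derive_expbump m q.[t] C0) (is_derive_poly q t).
have -> : polybump (p, m) q = horner p * (expbump C m \o horner q).
  by apply/funext => y; rewrite !fctE.
apply: (is_derive_eq (is_deriveM (is_derive_poly p t) dE)).
rewrite /polybump /= /GRing.scale /= -(expbumpS C m 2) -(expbumpS C (m + 1) 1).
rewrite addn2 !addn1 !(hornerD, hornerM, hornerN, hornerC, horner_exp).
by rewrite expr1; ring.
Qed.

(* These products form a class of functions closed under partial derivatives,
   so smoothness only requires differentiability and continuity. *)
Definition prodbump (pm : 'I_n -> {poly R} * nat) x : R :=
  \prod_j polybump (pm j) (w j) (x ord0 j).

Lemma is_derive_prodbump pm x i : is_derive x ((std_basis i : Rn)) (prodbump pm)
  (prodbump (fun j => if j == i then polybump_deriv (pm j) (w j) else pm j) x).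
Proof.
pose A := \prod_(j | j != i) polybump (pm j) (w j) (x ord0 j).
have E : prodbump pm \o setc x i = A \*: polybump (pm i) (w i).
  apply/funext => t; rewrite /= /prodbump (bigD1 i)//= mxE eqxx mulrC;
    congr (_ * _).
  by apply: eq_bigr => j ji; rewrite mxE (negbTE ji).
have D := is_deriveZ A (is_derive_polybump (pm i) (w i) (x ord0 i)).
have L : forall h : R, setc x i (h *: 1 + x ord0 i) =
    h *: (std_basis i : Rn) + setc x i (x ord0 i).
  by move=> h; rewrite -setc_line /GRing.scale /= mulr1.
move: D; rewrite -E => /(is_derive_line _ _ L); rewrite setc_id => D.
apply: (is_derive_eq D); rewrite /prodbump (bigD1 i)//= eqxx mulrC;
  congr (_ * _).
by apply: eq_bigr => j ji; rewrite (negbTE ji).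
Qed.

Lemma continuous_prodbump pm : continuous (prodbump pm).
Proof.
move=> x; rewrite /prodbump.
rewrite (_ : (fun x => _) = \prod_j (fun x =>
  polybump (pm j) (w j) (x ord0 j))); last first.
  by apply/funext => y; rewrite fct_prodE.
elim/big_ind : _ => [|f g cf cg|j _].
- exact: cst_continuous.
- exact: continuousM.
- apply: (@continuous_comp _ _ _ (fun y : Rn =>
  y ord0 j) (polybump (pm j) (w j))).
    exact: coord_continuous.
  apply/differentiable_continuous/derivable1_diffP.
  by have [] := is_derive_polybump (pm j) (w j) (x ord0 j).
Qed.

Lemma smooth_prodbump pm : smooth_on setT (prodbump pm).
Proof.
move=> s x _.
suff [pm' ->] : exists pm', foldr (@partial R n) (prodbump pm) s = prodbump pm'.
  split; first exact: continuous_prodbump.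
  by move=> i; have [] := is_derive_prodbump pm' x i.
elim: s => [|i s [pm' IH]] /=; first by exists pm.
rewrite IH; eexists; apply/funext => y; rewrite /partial.
by have [_ ->] := is_derive_prodbump pm' y i.
Qed.

End prodbump.

Section boxbump.
Context {R : realType} {n : nat}.
Local Notation Rn := 'rV[R]_n.
Implicit Types (l u x : Rn) (i j : 'I_n) (k : nat).

Definition boxbump l u k : Rn -> R :=
  prodbump k.+1%:R^-1 (fun j => ('X - (l ord0 j)%:P) * ((u ord0 j)%:P - 'X))
    (fun=> (1, 0%N)).

(** Nonemptiness matters: if [u_j < l_j], the quadratic [(x_j - l_j) (u_j - x_j)] is positive
    between [u_j] and [l_j], so the factor does not vanish there. *)
Lemma boxbump_out l u k x : box l u !=set0 -> ~ box l u x -> boxbump l u k x =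
  0.
Proof.
move=> [y yb]; rewrite /box /= => /existsNP[j hj].
rewrite /boxbump /prodbump (bigD1 j)//= /polybump /= /expbump ifF ?mulr0
  ?mul0r//.
rewrite !hornerE; have /andP[y1 y2] := yb j.
apply/negP => h; apply: hj; move: h.
have [xl|xl] := ltP (l ord0 j) (x ord0 j).
  by rewrite pmulr_rgt0 ?subr_gt0.
by move=> h; exfalso; nra.
Qed.

Lemma boxbump_itv l u k x : 0 <= boxbump l u k x <= 1.
Proof.
rewrite /boxbump /prodbump.
apply: (big_ind (fun z : R => 0 <= z <= 1)); first by rewrite ler01 lexx.
  by move=> a b /andP[a0 a1] /andP[b0 b1]; rewrite mulr_ge0// mulr_ile1.
move=> j _; rewrite /polybump hornerE mul1r /= /expbump.
case: ifP => h; last by rewrite lexx ler01.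
rewrite expr0 mul1r expR_ge0 -expR0 ler_expR oppr_le0 mulr_ge0 ?invr_ge0//.
exact: ltW.
Qed.

Lemma boxbump_cvg l u x : box l u x -> boxbump l u k x @[k --> \oo] --> (1 : R).
Proof.
move=> bx.
pose a j : R := (('X - (l ord0 j)%:P) * ((u ord0 j)%:P - 'X)).[x ord0 j].
have a0 j : 0 < a j.
  by have /andP[h1 h2] := bx j; rewrite /a !hornerE mulr_gt0// subr_gt0.
rewrite (_ : (fun k => _) = \prod_j (fun k =>
  expR (- (k.+1%:R^-1 * (a j)^-1)))); last first.
  apply/funext => k; rewrite fct_prodE; apply: eq_bigr => j _.
  by rewrite /polybump /= hornerE mul1r /expbump a0 expr0 mul1r.
rewrite [X in _ --> X](_ : 1 = \prod_(j < n) 1); last by rewrite big1_eq.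
apply: (big_ind2 (fun (f : nat -> R) (c : R) => f k @[k --> \oo] --> c)).
- exact: cvg_cst.
- by move=> f1 c1 f2 c2 h1 h2; exact: cvgM.
- move=> j _.
  have h : (fun k : nat => - (k.+1%:R^-1 * (a j)^-1)) @ \oo --> (0 : R).
    rewrite -oppr0; apply: cvgN; rewrite -(mul0r (a j)^-1).
    by apply: cvgM; [exact: cvg_harmonic|exact: cvg_cst].
  by have := cvg_comp _ _ h (@continuous_expR R 0); rewrite expR0.
Qed.

Lemma test_boxbump (U : set Rn) l u k : box l u !=set0 -> cbox l u `<=` U ->
  test_function U (boxbump l u k).
Proof.
move=> ne lU; split; first by apply: smooth_prodbump; rewrite invr_gt0.
exists (cbox l u); split => //; first exact: compact_cbox.
by move=> x nx; apply: boxbump_out => // /box_cbox.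
Qed.

End boxbump.

(** * Square-integrable functions *)

Section square_integrable.
Context d (T : measurableType d) (R : realType).
Variable mu : {measure set T -> \bar R}.
Implicit Types (D K : set T) (f g h : T -> R).

Lemma integrable_support D K f : measurable D -> measurable K -> K `<=` D ->
  (forall x, D x -> ~ K x -> f x = 0) ->
  mu.-integrable K (EFin \o f) -> mu.-integrable D (EFin \o f).
Proof.
move=> mD mK KD f0 /(integrable_mkcond _ mK) iK; apply/(integrable_mkcond _ mD).
rewrite (_ : _ \_ D = (EFin \o f) \_ K)//; apply/funext => x; rewrite !patchE.
have [Kx|Kx] := pselect (K x); first by rewrite !mem_set//; exact: KD.
rewrite [in RHS]memNset//.
have [Dx|Dx] := pselect (D x); last by rewrite memNset.
by rewrite mem_set//= f0.
Qed.

Lemma Rintegral_support D K f : K `<=` D -> (forall x,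
  D x -> ~ K x -> f x = 0) ->
  \int[mu]_(x in D) f x = \int[mu]_(x in K) f x.
Proof.
move=> KD f0; rewrite Rintegral_mkcond [RHS]Rintegral_mkcond.
congr Rintegral; apply/funext => x; rewrite !patchE.
have [Kx|Kx] := pselect (K x); first by rewrite !mem_set//; exact: KD.
rewrite [in RHS]memNset//.
have [Dx|Dx] := pselect (D x); last by rewrite memNset.
by rewrite mem_set//= f0.
Qed.

Lemma integrable_mul_bounded D f g (M : R) : measurable D ->
  mu.-integrable D (EFin \o f) -> measurable_fun D g ->
  (forall x, D x -> `|g x| <= M) -> mu.-integrable D (EFin \o (fun x =>
    f x * g x)).
Proof.
move=> mD fi mg gM.
have mf : measurable_fun D f by apply/measurable_EFinP;
  exact: (measurable_int mu fi).
apply: (@le_integrable _ _ _ mu D _ _ (EFin \o (fun x => M * `|f x|))) => //.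
- by apply/measurable_EFinP; exact: measurable_funM.
- move=> x Dx; rewrite /= lee_fin normrM mulrC.
  have M0 : 0 <= M by apply: le_trans (gM x Dx).
  by rewrite [leRHS]ger0_norm ?mulr_ge0// ler_wpM2r// gM.
- rewrite (_ : _ \o _ = (fun x => M%:E * (`|f x|%:E))%E)//.
  apply: integrableZl => //.
  by have := integrable_abse fi.
Qed.

(** A form of membership in L^2 for plain functions on [D], without the extension by zero made in
    [L2]; the two are identified in [L2P]. *)
Definition sqint D f :=
  measurable_fun D f /\ mu.-integrable D (EFin \o (fun x => f x ^+ 2)).

Lemma sqint_lin D f g (a b : R) : measurable D -> sqint D f -> sqint D g ->
  sqint D (fun x => a * f x + b * g x).
Proof.
move=> mD [mf fi] [mg gi].
have mh : measurable_fun D (fun x => a * f x + b * g x).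
  by apply: measurable_funD; apply: measurable_funM.
split=> //.
apply: (@le_integrable _ _ _ mu D _ _
    (fun x => (2 * a ^+ 2)%:E * (f x ^+ 2)%:E + (2 * b ^+ 2)%:E * (g x ^+
      2)%:E)%E) => //.
- by apply/measurable_EFinP; exact: measurable_funX.
- move=> x Dx; rewrite /= lee_fin ger0_norm ?sqr_ge0// ger0_norm; last first.
    by have := sqr_ge0 (a * f x); have := sqr_ge0 (b * g x); nra.
  by have := sqr_ge0 (a * f x - b * g x); nra.
- by apply: integrableD => //; apply: integrableZl.
Qed.

Lemma sqintM D f g : measurable D -> sqint D f -> sqint D g ->
  mu.-integrable D (EFin \o (fun x => f x * g x)).
Proof.
move=> mD [mf fi] [mg gi].
apply: (@le_integrable _ _ _ mu D _ _
    (fun x => (f x ^+ 2)%:E + (g x ^+ 2)%:E)%E) => //.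
- by apply/measurable_EFinP; exact: measurable_funM.
- move=> x Dx; rewrite /= lee_fin [leRHS]ger0_norm ?addr_ge0 ?sqr_ge0//.
  rewrite ler_norml; apply/andP; split.
    by have := sqr_ge0 (f x + g x); have := sqr_ge0 (f x);
      have := sqr_ge0 (g x); nra.
  by have := sqr_ge0 (f x - g x); have := sqr_ge0 (f x);
    have := sqr_ge0 (g x); nra.
- exact: integrableD.
Qed.

Lemma sqint_bounded D f g (M : R) : measurable D ->
  sqint D f -> measurable_fun D g -> (forall x, D x -> `|g x| <= M) ->
  sqint D (fun x => f x * g x).
Proof.
move=> mD [mf fi] mg gM; split; first exact: measurable_funM.
rewrite (_ : _ \o _ = EFin \o (fun x => f x ^+ 2 * g x ^+ 2)); last first.
  by apply/funext => x /=; rewrite exprMn.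
apply: (@integrable_mul_bounded _ _ _ (M ^+ 2)) => //.
  exact: measurable_funX.
by move=> x Dx; rewrite normrX lerXn2r ?nnegrE ?gM// (le_trans _ (gM x Dx)).
Qed.

Lemma integrable_ae_eq D f g : measurable D -> mu.-integrable D (EFin \o f) ->
  measurable_fun D g -> ae_eq mu D f g -> mu.-integrable D (EFin \o g).
Proof.
move=> mD fi mg fg; have mf := measurable_int mu fi.
apply/integrableP; split; first exact/measurable_EFinP.
have /integrableP[_] := fi; apply: le_lt_trans.
rewrite le_eqVlt; apply/orP; left; apply/eqP; apply: ae_eq_integral => //.
- by apply: measurableT_comp => //; exact/measurable_EFinP.
- exact: measurableT_comp.
- by apply: filterS fg => x h Dx /=; rewrite h.
Qed.

Lemma sqint_ae D f g : measurable D -> sqint D f -> measurable_fun D g ->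
  ae_eq mu D f g -> sqint D g.
Proof.
move=> mD [mf fi] mg fg; split => //.
apply: (@integrable_ae_eq _ (fun x => f x ^+ 2)) => //.
  exact: measurable_funX.
by apply: filterS fg => x h Dx /=; rewrite h.
Qed.

Lemma ae_eq_Rintegral D f g : measurable D -> measurable_fun D f ->
  measurable_fun D g -> ae_eq mu D f g ->
  \int[mu]_(x in D) f x = \int[mu]_(x in D) g x.
Proof.
move=> mD mf mg fg; congr fine; apply: ae_eq_integral => //;
  try exact/measurable_EFinP.
by apply: filterS fg => x h Dx /=; rewrite h.
Qed.

(** The discriminant of a nonnegative quadratic, read off at its minimizer [- P / G]. When [G = 0]
    the expression is affine in [t], and if [P] were nonzero the chosen [t] would give it the value
    -1. *)
Lemma quadratic_ge0 (F P G : R) : 0 <= G ->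
  (forall t, 0 <= F + 2 * t * P + t ^+ 2 * G) -> P ^+ 2 <= F * G.
Proof.
rewrite le_eqVlt => /predU1P[<-|G0] h.
  rewrite mulr0; have [->|P0] := eqVneq P 0; first by rewrite expr0n.
  exfalso; have := h (- (F + 1) / (2 * P)); rewrite mulr0 addr0.
  have -> : 2 * (- (F + 1) / (2 * P)) * P = - (F + 1) by field.
  lra.
have := h (- P / G).
have -> : F + 2 * (- P / G) * P + (- P / G) ^+ 2 * G = (F * G - P ^+ 2) / G.
  by field; rewrite gt_eqF.
by rewrite pmulr_lge0 ?invr_gt0// subr_ge0.
Qed.

Lemma RintegralD3 D f g h : measurable D ->
  mu.-integrable D (EFin \o f) -> mu.-integrable D (EFin \o g) ->
  mu.-integrable D (EFin \o h) ->
  \int[mu]_(x in D) (f x + g x + h x) =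
  \int[mu]_(x in D) f x + \int[mu]_(x in D) g x + \int[mu]_(x in D) h x.
Proof.
move=> mD fi gi hi; rewrite RintegralD//; first by rewrite RintegralD.
rewrite (_ : _ \o _ = (fun x => (f x)%:E + (g x)%:E)%E)//.
exact: integrableD.
Qed.

Lemma integrable_scale D f (a : R) : measurable D ->
  mu.-integrable D (EFin \o f) -> mu.-integrable D (EFin \o (fun x => a * f x)).
Proof.
move=> mD fi; rewrite (_ : _ \o _ = (fun x => a%:E * (f x)%:E)%E)//.
exact: integrableZl.
Qed.

Lemma Rintegral_cauchy_schwarz D f g : measurable D -> sqint D f -> sqint D g ->
  (\int[mu]_(x in D) (f x * g x)) ^+ 2 <=
  \int[mu]_(x in D) (f x ^+ 2) * \int[mu]_(x in D) (g x ^+ 2).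
Proof.
move=> mD sf sg; apply: quadratic_ge0.
  by apply: Rintegral_ge0 => x _; exact: sqr_ge0.
move=> t.
have -> : \int[mu]_(x in D) (f x ^+ 2) + 2 * t * (\int[mu]_(x in D) (f x * g
  x)) +
    t ^+ 2 * (\int[mu]_(x in D) (g x ^+ 2)) =
    \int[mu]_(x in D) ((f x + t * g x) ^+ 2).
  have fg := sqintM mD sf sg.
  case: sf sg => mf fi [mg gi].
  rewrite -RintegralZl// -RintegralZl// -RintegralD3//; first last.
  - exact: integrable_scale.
  - exact: integrable_scale.
  - by apply: eq_Rintegral => x _; ring.
by apply: Rintegral_ge0 => x _; exact: sqr_ge0.
Qed.

Lemma sqint0_ae D f : measurable D -> sqint D f ->
  \int[mu]_(x in D) (f x ^+ 2) = 0 -> ae_eq mu D f (cst 0).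
Proof.
move=> mD [mf fi] f0.
have mf2 : measurable_fun D (EFin \o (fun x => f x ^+ 2)).
  by apply/measurable_EFinP; exact: measurable_funX.
have : ae_eq mu D (EFin \o (fun x => f x ^+ 2)) (cst 0%E).
  apply/(ae_eq_integral_abs mu mD mf2).
  rewrite -[LHS]fineK; last by apply: integrable_fin_num => //;
    exact: integrable_abse.
  congr EFin; rewrite -[RHS]f0; congr fine; apply: eq_integral => x _.
  by rewrite /= ger0_norm ?sqr_ge0.
apply: filterS => x h Dx; have [/eqP] := h Dx.
by rewrite sqrf_eq0 => /eqP.
Qed.

End square_integrable.

(** * Completeness of L^2 *)

Lemma cvgn_summable_increments (R : realType) (u del : R ^nat) :
  (forall k, 0 < del k) -> cvgn (series del) ->
  (\sum_(k <oo) ((del k)^-1 * (u k.+1 - u k) ^+ 2)%:E < +oo)%E -> cvgn u.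
Proof.
move=> del0 cdel Sfin.
pose h k := (del k)^-1 * (u k.+1 - u k) ^+ 2.
have h0 k : 0 <= h k by rewrite /h mulr_ge0 ?sqr_ge0// invr_ge0 ltW.
have ch : cvgn (series h).
  apply: nondecreasing_is_cvgn; first exact: nondecreasing_series.
  exists (fine (\sum_(k <oo) (h k)%:E)%E) => _ [k _ <-].
  rewrite -lee_fin fineK.
    by rewrite seriesEnat /= -sumEFin; apply: nneseries_lim_ge => i _ _;
      rewrite lee_fin.
  rewrite ge0_fin_numE//; apply: nneseries_ge0 => i _ _; by rewrite lee_fin.
have cn : cvgn [normed series (telescope u)].
  apply: (@series_le_cvg _ _ (fun k => del k + h k)) => //.
  - by move=> k; rewrite /= normr_ge0.
  - by move=> k; rewrite addr_ge0// ltW.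
  - move=> k; rewrite /telescope /= /h.
    (* AM-GM: [`|v| <= del + v ^+ 2 / del] *)
    have := sqr_ge0 (`|u k.+1 - u k| - del k); have := del0 k.
    rewrite -(real_normK (num_real (u k.+1 - u k))).
    set v := `|_|; have v0 : 0 <= v by exact: normr_ge0.
    move=> d0 sq; rewrite -(ler_pM2l d0) mulrDr mulVKf ?gt_eqF//; nra.
  - have -> : series (fun k => del k + h k) = series del \+ series h.
      by apply/funext => k; rewrite !seriesEnat /= big_split.
    exact: is_cvgD.
have := normed_cvg cn; rewrite telescopeK => c.
rewrite (_ : u = (fun k => (u k - u 0%N) + cst (u 0%N) k)).
  by apply: is_cvgD => //; exact: is_cvg_cst.
by apply/funext => k; rewrite subrK.
Qed.

Lemma limn_einf_le (R : realType) (u : (\bar R)^nat) (e : \bar R) :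
  (\forall k \near \oo, (u k <= e)%E) -> (limn_einf u <= e)%E.
Proof.
move=> h; rewrite limn_einf_lim; apply: lime_le; first exact: is_cvg_einfs.
near=> k; apply: (@le_trans _ _ (u k)); last by near: k.
by apply: ereal_inf_lbound; exists k => /=.
Unshelve. all: by end_near. Qed.

Section riesz_fischer.
Context d (T : measurableType d) (R : realType).
Variable mu : {measure set T -> \bar R}.
Variables (D : set T) (mD : measurable D).
Implicit Types (f g : T -> R).

Lemma sqintB f g : sqint mu D f -> sqint mu D g -> sqint mu D (fun x =>
  f x - g x).
Proof.
move=> sf sg; rewrite (_ : (fun x => _) = (fun x => 1 * f x + (-1) * g x)).
  exact: sqint_lin.
by apply/funext => x; rewrite mul1r mulN1r.
Qed.

Lemma sqintD f g : sqint mu D f -> sqint mu D g -> sqint mu D (fun x =>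
  f x + g x).
Proof.
move=> sf sg; rewrite (_ : (fun x => _) = (fun x => 1 * f x + 1 * g x)).
  exact: sqint_lin.
by apply/funext => x; rewrite !mul1r.
Qed.

(** Along a subsequence whose increments have squared norm at most [del k ^+ 2], with
    [del k = 2^-(k+1)], the squared increments divided by [del k] have integrals summing to at most
    the sum of the [del k]. Their sum [S] is therefore finite a.e., and the subsequence converges
    there. Weighting squares in this way replaces the Minkowski inequality; Fatou then gives
    convergence in norm. *)
Lemma riesz_fischer (f : (T -> R)^nat) : (forall k, sqint mu D (f k)) ->
  (forall e, 0 < e -> exists N, forall k l, (N <= k)%N -> (N <= l)%N ->
     \int[mu]_(x in D) ((f k x - f l x) ^+ 2) <= e) ->
  exists2 g, sqint mu D g &
    (forall e, 0 < e -> exists N, forall k, (N <= k)%N ->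
     \int[mu]_(x in D) ((g x - f k x) ^+ 2) <= e).
Proof.
move=> sf cf.
pose del k : R := 1 / (2 ^ (k + 1))%:R.
have del0 k : 0 < del k by rewrite divr_gt0// ltr0n expn_gt0.
have [N hN] : {N : nat -> nat & forall j k l, (N j <= k)%N -> (N j <= l)%N ->
     \int[mu]_(x in D) ((f k x - f l x) ^+ 2) <= del j ^+ 2}.
  by apply: (@choice _ _ (fun j N => forall k l, (N <= k)%N -> (N <= l)%N ->
     \int[mu]_(x in D) ((f k x - f l x) ^+ 2) <= del j ^+ 2)) => j;
       apply: cf; rewrite exprn_gt0.
(* The successor makes the subsequence strictly increasing, and [N k] makes its [k]-th increment
   small enough. *)
pose phi := fix F k := if k is k'.+1 then maxn (F k').+1 (N k'.+1) else N 0%N.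
have phiN k : (N k <= phi k)%N by case: k => //= k; exact: leq_maxr.
have phiS k : (phi k < phi k.+1)%N by exact: leq_maxl.
have phik k : (k <= phi k)%N by elim: k => // k IH;
  exact: leq_ltn_trans (phiS k).
pose g k := f (phi k).
have sg k : sqint mu D (g k) by exact: sf.
pose h k x := (del k)^-1 * (g k.+1 x - g k x) ^+ 2.
have mh k : measurable_fun D (h k).
  apply: measurable_funM => //; apply: measurable_funX; apply: measurable_funB.
    exact: (sg _).1.
  exact: (sg _).1.
have h0 k x : 0 <= h k x by rewrite /h mulr_ge0 ?sqr_ge0// invr_ge0 ltW.
have ih k : (\int[mu]_(x in D) (h k x)%:E <= (del k)%:E)%E.
  have i2 := (sqintB (sg k.+1) (sg k)).2.
  have ihk := integrable_scale (del k)^-1 mD i2.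
  rewrite -[leLHS]fineK; last exact: integrable_fin_num.
  rewrite lee_fin -/(Rintegral mu D (h k)) RintegralZl// ler_pdivrMl// -expr2.
  by apply: hN => //; apply: leq_trans (phiN k) (ltnW (phiS k)).
pose S x := (\sum_(k <oo) (h k x)%:E)%E.
have mS : measurable_fun D S.
  apply: (@ge0_emeasurable_sum _ _ _ _ (fun k x => (h k x)%:E) xpredT) => //.
    by move=> k x Dx _; rewrite lee_fin.
  by move=> k _; exact/measurable_EFinP.
have S0 x : (0 <= S x)%E by apply: nneseries_ge0 => k _ _; rewrite lee_fin.
have iS : mu.-integrable D S.
  apply/integrableP; split => //.
  under eq_integral do rewrite gee0_abs//.
  rewrite integral_nneseries//; first last.
  - by move=> k x Dx; rewrite lee_fin.
  - by move=> k; exact/measurable_EFinP.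
  apply: (@le_lt_trans _ _ (\sum_(k <oo) (del k)%:E)%E).
    by apply: lee_nneseries => // k _ _; apply: integral_ge0 => x _;
      rewrite lee_fin.
  have /cvg_lim -> // := @cvg_geometric_eseries_half R 1 0.
  by rewrite ltry.
have cdel : cvgn (series del) by apply/cvg_ex; exists (1 / 2 ^+ 0);
  exact: cvg_geometric_series_half.
have aeg : {ae mu, forall x, D x -> cvgn (g ^~ x)}.
  have := integrable_ae mD iS; apply: filterS => x Sx Dx.
  apply: (cvgn_summable_increments del0 cdel).
  by rewrite -ge0_fin_numE ?Sx//; exact: S0.
(* An upper limit is measurable on all of [D] with no reference to the set of convergence, and
   agrees with the limit wherever that limit exists. *)
pose G x := fine (limn_esup (fun k => (g k x)%:E)).
have mG : measurable_fun D G.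
  apply: measurableT_comp => //.
  by apply: measurable_fun_limn_esup => k; apply/measurable_EFinP;
    exact: (sg k).1.
have aeG : {ae mu, forall x, D x -> g ^~ x @ \oo --> G x}.
  move: aeg; apply: filterS => x c Dx; have {}c := c Dx.
  rewrite /G (_ : limn_esup _ = (limn (g ^~ x))%:E)//.
  by apply/(cvg_limn_einf_sup _).2; apply: cvg_EFin => //; exact: nearW.
have main j k : (N j <= k)%N ->
    (\int[mu]_(x in D) ((G x - f k x) ^+ 2)%:E <= (del j ^+ 2)%:E)%E.
  move=> Njk.
  rewrite (@ae_eq_integral _ _ _ mu D (fun x => limn_einf (fun l =>
    ((g l x - f k x) ^+ 2)%:E))) //.
  - apply: le_trans.
      apply: fatou => //.
        move=> l; apply/measurable_EFinP; apply: measurable_funX;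
          apply: measurable_funB.
          exact: (sg l).1.
        exact: (sf k).1.
      by move=> l x Dx; rewrite lee_fin sqr_ge0.
    apply: limn_einf_le; near=> l.
    have i2 := (sqintB (sg l) (sf k)).2.
    rewrite -[leLHS]fineK; last exact: integrable_fin_num.
    rewrite lee_fin; apply: hN => //; apply: leq_trans (phik l).
    by near: l; exact: nbhs_infty_ge.
  - apply/measurable_EFinP; apply: measurable_funX;
    apply: measurable_funB => //.
    exact: (sf k).1.
  - rewrite /limn_einf; apply: measurableT_comp => //.
    apply: measurable_fun_limn_esup => l; apply: measurableT_comp => //.
    apply/measurable_EFinP; apply: measurable_funX; apply: measurable_funB.
      exact: (sg l).1.
    exact: (sf k).1.
  - move: aeG; apply: filterS => x c Dx; have {}c := c Dx.
    apply/esym/(cvg_limn_einf_sup _).1; apply: cvg_EFin; first exact: nearW.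
    rewrite !expr2; apply: cvgM; apply: cvgB => //; exact: cvg_cst.
(* Fatou bounds only differences [G - f k]; square-integrability of [G] itself follows by adding one
   term of the sequence back. *)
have sGf : sqint mu D (fun x => G x - f (phi 0%N) x).
  split; first by apply: measurable_funB => //; exact: (sf _).1.
  apply/integrableP; split.
    by apply/measurable_EFinP; apply: measurable_funX;
      apply: measurable_funB => //; exact: (sf _).1.
  under eq_integral do rewrite gee0_abs ?lee_fin ?sqr_ge0//.
  by apply: le_lt_trans (main 0%N (phi 0%N) _) _ => //; rewrite ltry.
exists G.
  have := sqintD sGf (sf (phi 0%N)).
  by under [X in sqint _ _ X -> _]eq_fun do rewrite subrK.
move=> e e0.
have [j je] : exists j, del j ^+ 2 <= e.
  have /cvgrPdist_lt/(_ (Num.min 1 e)) := cvg_series_cvg_0 cdel.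
  rewrite lt_min ltr01 e0 => /(_ isT)[j _ /(_ j (leqnn j)) /=].
  rewrite sub0r normrN lt_min gtr0_norm// => /andP[d1 de]; exists j.
  have := del0 j; nra.
exists (N j) => k Njk.
rewrite -lee_fin; apply: (@le_trans _ _ (del j ^+ 2)%:E);
  last by rewrite lee_fin.
apply: le_trans (main j k Njk).
rewrite le_eqVlt fineK ?eqxx// ge0_fin_numE.
  by apply: le_lt_trans (main j k Njk) _; rewrite ltry.
by apply: integral_ge0 => x _; rewrite lee_fin sqr_ge0.
Unshelve. all: by end_near. Qed.

End riesz_fischer.

(** * Integration by parts on R^n *)

Section divergence_box.
Context {R : realType}.

Lemma compact_continuous_bounded (V : topologicalType) (K : set V) (f : V ->
  R) :
  compact K -> {within K, continuous f} -> exists M, forall x,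
    K x -> `|f x| <= M.
Proof.
move=> cK cf; have /compact_bounded[M [_ h]] := continuous_compact cf cK.
exists (M + 1) => x Kx; apply: (h (M + 1)); first by rewrite ltrDl.
by exists x.
Qed.

Lemma integrable_box_support n (l u : 'rV[R]_n) (G : 'rV[R]_n -> R) :
  continuous G -> (forall x, ~ cbox l u x -> G x = 0) ->
  (lebesgue_rV R n).-integrable setT (EFin \o G).
Proof.
move=> cG G0.
have mK : measurable (cbox l u) by apply: compact_measurable_rV;
  exact: compact_cbox.
apply: (@integrable_support _ _ _ _ _ (cbox l u)) => //.
  by move=> x _; exact: G0.
have [M hM] := compact_continuous_bounded (@compact_cbox _ _ l u)
  (continuous_subspaceT cG).
have mG : measurable_fun (cbox l u) G.
  by apply: measurable_funTS; apply: open_continuous_measurable_rV => [|x _];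
    [exact: openT|exact: cG].
rewrite (_ : G = fun x => cst 1 x * G x); last by apply/funext => x;
  rewrite mul1r.
apply: (@integrable_mul_bounded _ _ _ _ _ (cst 1) _ M) => //.
- apply/integrableP; split; first exact/measurable_EFinP/measurable_cst.
  rewrite (eq_integral (cst 1%E)); last by move=> x _ /=; rewrite normr1.
  rewrite integral_cst// mul1e.
  exact: (compact_finite_vol (@compact_cbox _ _ l u)).
Qed.

(** The fundamental theorem of calculus on [[a, b]]: [F] vanishes off the open interval, hence at
    both endpoints. *)
Lemma integral_derive_support (F G : R -> R) (a b : R) : a < b ->
  continuous G -> (forall t : R, is_derive t 1 F (G t)) ->
  (forall t, ~~ (a < t < b) -> F t = 0) -> (forall t,
    ~~ (a <= t <= b) -> G t = 0) ->
  (\int[lebesgue_measure]_t (G t)%:E = 0)%E.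
Proof.
move=> ab cG dF F0 G0.
have cF : continuous F.
  by move=> t; apply/differentiable_continuous/derivable1_diffP;
    have [] := dF t.
transitivity (\int[lebesgue_measure]_(t in `[a, b]) (G t)%:E)%E.
  rewrite [RHS]integral_mkcond; apply: eq_integral => t _; rewrite patchE.
  by case: ifPn => // tab; rewrite G0//; apply: contra tab;
    rewrite inE /= in_itv.
rewrite (@continuous_FTC2 _ G F)//.
- by rewrite !F0 ?ltxx ?andbF// subee.
- exact: continuous_subspaceT.
- split; first by move=> t _; have [] := dF t.
    by apply: cvg_at_right_filter; exact: cF.
  by apply: cvg_at_left_filter; exact: cF.
- by move=> t _; rewrite derive1E; have [] := dF t.
Qed.

Lemma continuous_rV (T : topologicalType) n (f : T -> 'rV[R]_n) :
  (forall j, continuous (fun t => f t ord0 j)) -> continuous f.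
Proof.
move=> cf x; apply/cvg_ballP => e e0.
have : \forall z \near x, forall j, ball (f x ord0 j) e (f z ord0 j).
  by apply: filter_forall => j; have /cvg_ballP/(_ _ e0) := cf j x.
by apply: filterS => z h; split=> // i j; rewrite ord1; exact: h.
Qed.

Lemma continuous_rV_consl n (y : 'rV[R]_n) : continuous (fun t : R =>
  rV_cons (t, y)).
Proof.
apply: continuous_rV => j; under eq_fun do rewrite mxE.
by case: unliftP => [k|] _ x; [exact: cvg_cst|exact: cvg_id].
Qed.

Lemma continuous_rV_consr n (t : R) : continuous (fun y : 'rV[R]_n =>
  rV_cons (t, y)).
Proof.
apply: continuous_rV => j; under eq_fun do rewrite mxE.
by case: unliftP => [k|] _ x; [exact: coord_continuous|exact: cst_continuous].
Qed.

Lemma rV_cons_line0 n (y : 'rV[R]_n) (t h : R) :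
  rV_cons (h + t, y) = h *: (std_basis ord0 : 'rV[R]_n.+1) + rV_cons (t, y).
Proof.
apply/rowP => j; rewrite !mxE eqxx /=.
by case: unliftP => [k|] -> /=; rewrite ?mulr0 ?mulr1 ?add0r.
Qed.

Lemma rV_cons_lineS n (y : 'rV[R]_n) (t h : R) (i : 'I_n) :
  rV_cons (t, h *: (std_basis i) + y) =
  h *: (std_basis (lift ord0 i) : 'rV[R]_n.+1) + rV_cons (t, y).
Proof.
apply/rowP => j; rewrite !mxE eqxx /=.
case: unliftP => [k|] -> /=; last by rewrite mulr0 add0r.
by rewrite !mxE eqxx (inj_eq lift_inj).
Qed.

(** Induction on the dimension along the recursive construction of the measure. By Fubini, the inner
    integral runs over the first coordinate when [i] is that coordinate, where the one-variable case
    applies, and over the remaining ones otherwise, where the induction hypothesis does. *)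
Lemma integral_partial_support n (i : 'I_n) (l u : 'rV[R]_n)
    (F G : 'rV[R]_n -> R) :
  continuous G -> (forall x, is_derive x (std_basis i : 'rV[R]_n) F (G x)) ->
  (forall x, ~ box l u x -> F x = 0) -> (forall x, ~ cbox l u x -> G x = 0) ->
  (\int[lebesgue_rV R n]_x (G x)%:E = 0)%E.
Proof.
elim: n i l u F G => [[]//|n IH] i l u F G cG dF F0 G0.
(* The one-variable case needs a nondegenerate interval. An empty box forces [F], hence its
   derivative [G], to vanish identically. *)
have [lu|lu] := pselect (forall j, l ord0 j < u ord0 j); last first.
  have FE : F = cst 0.
    apply/funext => x; apply: F0 => bx; apply: lu => j.
    by have /andP[] := bx j; exact: lt_trans.
  apply: integral0_eq => x _; congr EFin.
  by have [_ <-] := dF x; rewrite FE derive_cst.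
have iG := integrable_box_support cG G0.
have mG : measurable_fun setT (EFin \o G) by exact: (measurable_int _ iG).
have mc := @measurable_rV_cons R n.
pose m1 := @lebesgue_measure R; pose m2 := lebesgue_rV R n.
have iGc : (m1 \x m2)%E.-integrable setT ((EFin \o G) \o @rV_cons R n).
  apply/integrableP; split; first exact: measurableT_comp.
  have /integrableP[_] := iG; apply: le_lt_trans.
  rewrite /lebesgue_rV -/lebesgue_rV /lebesgue_rV_step
    ge0_integral_pushforward//.
  exact: measurableT_comp.
rewrite /lebesgue_rV -/lebesgue_rV /lebesgue_rV_step integral_pushforward//.
rewrite preimage_setT.
have [i0|[j ij]] : i = ord0 \/ exists j, i = lift ord0 j.
  by case: (unliftP ord0 i) => [j|] ->; [right; exists j|left].
- rewrite -(integral21_prod_meas1 iGc); apply: integral0_eq => y _ /=.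
  have cy : continuous (fun t => G (rV_cons (t, y))).
    by move=> t; apply: continuous_comp; [exact: continuous_rV_consl|exact: cG].
  apply: (@integral_derive_support (fun t =>
    F (rV_cons (t, y))) _ (l ord0 ord0) (u ord0 ord0)) => //.
  + move=> t; have := dF (rV_cons (t, y)); rewrite i0.
    apply: (@is_derive_line _ _ _ _ F (fun t =>
      rV_cons (t, y)) _ t 1 _ _).2 => h.
    by rewrite -rV_cons_line0 /GRing.scale /= mulr1.
  + by move=> t nt; apply: F0 => /(_ ord0); rewrite mxE unlift_none; apply/negP.
  + by move=> t nt; apply: G0 => /(_ ord0); rewrite mxE unlift_none; apply/negP.
- rewrite -(integral12_prod_meas1 iGc); apply: integral0_eq => t _ /=.
  apply: (IH j (rV_behead l) (rV_behead u) (fun y => F (rV_cons (t, y)))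
    (fun y => G (rV_cons (t, y)))) => //.
  + by move=> y; apply: continuous_comp; [exact: continuous_rV_consr|exact: cG].
  + move=> y; have := dF (rV_cons (t, y)); rewrite ij.
    apply: (@is_derive_line _ _ _ _ F (fun y =>
      rV_cons (t, y)) _ y (std_basis j) _ _).2 => h.
    exact: rV_cons_lineS.
  + move=> y ny; apply: F0 => h; apply: ny => k.
    by have := h (lift ord0 k); rewrite !mxE liftK.
  + move=> y ny; apply: G0 => h; apply: ny => k.
    by have := h (lift ord0 k); rewrite !mxE liftK.
Qed.

End divergence_box.

(** * Test functions and weak derivatives *)

Section test_functions.
Context {R : realType} {n : nat}.
Local Notation Rn := 'rV[R]_n.
Local Notation vol := (lebesgue_rV R n).
Implicit Types (U K : set Rn) (p q u d : Rn -> R) (i : 'I_n).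

Lemma smooth_continuous p : smooth_on setT p -> continuous p.
Proof. by move=> sp x; have [] := sp [::] x I. Qed.

Lemma smooth_derive p i x : smooth_on setT p ->
  is_derive x (std_basis i) p (partial i p x).
Proof. by move=> sp; apply: DeriveDef => //;
  have [_ /(_ i)] := sp [::] x I. Qed.

Lemma smooth_partial p i : smooth_on setT p -> smooth_on setT (partial i p).
Proof. by move=> sp s x _; have := sp (rcons s i) x I; rewrite foldr_rcons. Qed.

Lemma foldr_partial_lin p q (a b : R) s :
  smooth_on setT p -> smooth_on setT q ->
  foldr (@partial R n) (fun x => a * p x + b * q x) s =
  (fun x => a * foldr (@partial R n) p s x + b * foldr (@partial R n) q s x).
Proof.
move=> sp sq; elim: s => //= i s ->; apply/funext => x.
have [_ /(_ i) dp] := sp s x I; have [_ /(_ i) dq] := sq s x I.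
have Dp := @is_deriveZ _ _ _ _ a _ _ _ (DeriveDef dp erefl).
have Dq := @is_deriveZ _ _ _ _ b _ _ _ (DeriveDef dq erefl).
by have [_ E] := is_deriveD Dp Dq; exact: E.
Qed.

Lemma smooth_lin p q (a b : R) : smooth_on setT p -> smooth_on setT q ->
  smooth_on setT (fun x => a * p x + b * q x).
Proof.
move=> sp sq s x _; rewrite foldr_partial_lin//.
have [cp dp] := sp s x I; have [cq dq] := sq s x I; split.
  by apply: continuousD; apply: continuousM => //; exact: cst_continuous.
move=> i.
have Dp := @is_deriveZ _ _ _ _ a _ _ _ (DeriveDef (dp i) erefl).
have Dq := @is_deriveZ _ _ _ _ b _ _ _ (DeriveDef (dq i) erefl).
by have [] := is_deriveD Dp Dq.
Qed.

Lemma closed_compact_rV K : compact K -> closed K.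
Proof. by move=> cK; exact: compact_closed. Qed.

Lemma partial_out p i K x : compact K -> (forall y,
  ~ K y -> p y = 0) -> ~ K x ->
  partial i p x = 0.
Proof.
move=> cK p0 nKx; rewrite /partial (@near_eq_derive _ _ _ _ (cst 0))
  ?derive_cst//.
have : nbhs x (~` K).
  by apply: open_nbhs_nbhs; split => //; apply: closed_openC;
    exact: closed_compact_rV.
by apply: filterS => y nKy; rewrite p0.
Qed.

Lemma test_partial U p i : test_function U p -> test_function U (partial i p).
Proof.
move=> [sp [K [cK KU p0]]]; split; first exact: smooth_partial.
by exists K; split => // x; exact: partial_out.
Qed.

Lemma test_lin U p q (a b : R) : test_function U p -> test_function U q ->
  test_function U (fun x => a * p x + b * q x).
Proof.
move=> [sp [K [cK KU p0]]] [sq [L [cL LU q0]]]; split; first exact: smooth_lin.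
exists (K `|` L); split; [exact: compactU|by rewrite subUset|].
by move=> x /not_orP[/p0 -> /q0 ->]; rewrite !mulr0 addr0.
Qed.

Lemma test0 U : test_function U (cst 0).
Proof.
split; last by exists set0; split => //; exact: compact0.
have E s : foldr (@partial R n) (cst 0) s = cst 0.
  by elim: s => //= i s ->; apply/funext => x; rewrite /partial derive_cst.
by move=> s x _; rewrite E; split; [exact: cst_continuous|move=> i;
  exact: derivable_cst].
Qed.

Lemma test_continuous U p : test_function U p -> continuous p.
Proof. by move=> [/smooth_continuous]. Qed.

Lemma continuous_measurable_rV p (D : set Rn) : measurable D -> continuous p ->
  measurable_fun D p.
Proof.
move=> mD cp; apply: (@measurable_funS _ _ _ _ setT) => //.
by apply: open_continuous_measurable_rV => [|x _]; [exact: openT|exact: cp].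
Qed.

Lemma test_bounded U p : test_function U p -> exists M, forall x, `|p x| <= M.
Proof.
move=> /[dup] tp [_ [K [cK _ p0]]].
have [M hM] := compact_continuous_bounded cK (continuous_subspaceT
  (test_continuous tp)).
exists (Num.max M 0) => x; rewrite le_max; have [Kx|nKx] := pselect (K x).
  by rewrite hM.
by rewrite p0// normr0 lexx orbT.
Qed.

Lemma L1loc_test U d p : open U -> L1loc U d -> test_function U p ->
  vol.-integrable U (EFin \o (fun x => d x * p x)).
Proof.
move=> oU ld /[dup] tp [_ [K [cK KU p0]]].
have mK := compact_measurable_rV cK.
have [M hM] := test_bounded tp.
apply: (@integrable_support _ _ _ _ _ K) => //; first exact: open_measurable_rV.
  by move=> x _ /p0 ->; rewrite mulr0.
apply: (@integrable_mul_bounded _ _ _ _ _ _ _ M) => //; first exact: ld.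
by apply: continuous_measurable_rV => //; exact: test_continuous tp.
Qed.

Lemma L1loc_measurable U d : open U -> L1loc U d -> measurable_fun U d.
Proof.
move=> oU ld; have [P [l [u [UE h]]]] := open_bigcup_box oU.
rewrite UE bigcup_mkcond; apply/measurable_fun_bigcup => k.
  by case: ifP => // _; exact: measurable_box.
case: ifPn => [|_]; last exact: measurable_fun_set0.
rewrite inE => /h; move=> hk.
apply: (@measurable_funS _ _ _ _ (cbox (l k) (u k))).
- by apply: compact_measurable_rV; exact: compact_cbox.
- exact: box_cbox.
- by apply/measurable_EFinP; apply: (measurable_int vol); apply: ld;
  [exact: compact_cbox|exact: hk].
Qed.

(** Countably many boxes reduce the claim to one on which [d] is integrable. On each of its subboxes
    the bumps lie between 0 and 1, so [|d|] dominates and the zero integrals of [d] against the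
    bumps pass to the limit. *)
Lemma fundamental_lemma U d : open U -> L1loc U d ->
  (forall p, test_function U p -> \int[vol]_(x in U) (d x * p x) = 0) ->
  {ae vol, forall x, U x -> d x = 0}.
Proof.
move=> oU ld d0; have [P [l [u [UE h]]]] := open_bigcup_box oU.
suff : {ae vol, forall x, forall k, P k -> box (l k) (u k) x -> d x = 0}.
  by apply: filterS => x hx; rewrite UE => -[k Pk]; exact: hx.
apply: ae_foralln => k.
have [Pk|nPk] := pselect (P k); last by apply: aeW => x.
have idk : vol.-integrable (cbox (l k) (u k)) (EFin \o d).
  by apply: ld; [exact: compact_cbox|exact: h].
have mk : measurable (cbox (l k) (u k)).
  by apply: compact_measurable_rV; exact: compact_cbox.
suff : ae_eq vol (box (l k) (u k)) d (cst 0) by apply: filterS => x hx _.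
apply: ae0_of_boxes.
  by apply: integrableS idk => //; [exact: measurable_box|exact: box_cbox].
move=> l' u' bb cc.
(* Bumps are supported in their box only if it is nonempty; an empty box contributes nothing. *)
have [ne|] := pselect (box l' u' !=set0); last first.
  by move=> /set0P/negP/negPn/eqP ->; rewrite integral_set0.
have mB : measurable (box l' u') by exact: measurable_box.
have idB : vol.-integrable (box l' u') (EFin \o d).
  by apply: integrableS idk => //; exact: subset_trans bb (@box_cbox _ _ _ _).
have tb j : test_function U (boxbump l' u' j).
  by apply: test_boxbump => //; apply: subset_trans cc _; exact: h.
have mb j : measurable_fun (box l' u') (boxbump l' u' j).
  by apply: continuous_measurable_rV => //; exact: test_continuous (tb j).
have i0 j : (\int[vol]_(x in box l' u') (d x * boxbump l' u' j x)%:E = 0)%E.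
  have ij : vol.-integrable (box l' u') (EFin \o (fun x =>
    d x * boxbump l' u' j x)).
    apply: (@integrable_mul_bounded _ _ _ _ _ _ _ 1) => // x _.
    by have /andP[b0 b1] := boxbump_itv l' u' j x; rewrite ger0_norm.
  rewrite -[LHS]fineK; last exact: integrable_fin_num.
  congr EFin; rewrite -[RHS](d0 _ (tb j)); apply/esym/Rintegral_support.
    by apply: subset_trans (h k Pk); apply: subset_trans cc; exact: box_cbox.
  by move=> x _ nb; rewrite boxbump_out ?mulr0.
have md : measurable_fun (box l' u') (EFin \o d) by exact: (measurable_int vol
  idB).
pose dj j x := (d x * boxbump l' u' j x)%:E.
have mdj j : measurable_fun (box l' u') (dj j).
  by apply/measurable_EFinP/measurable_funM => //; exact/measurable_EFinP.
have cdj : {ae vol, forall x, box l' u' x -> dj ^~ x @ \oo --> (EFin \o d) x}.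
  apply: aeW => x bx; apply: cvg_EFin; first exact: nearW.
  rewrite -[X in _ --> X]mulr1; apply: cvgM; first exact: cvg_cst.
  exact: boxbump_cvg.
have bdj : {ae vol, forall x j,
  box l' u' x -> (`|dj j x| <= (abse \o (EFin \o d)) x)%E}.
  apply: aeW => x j bx /=; rewrite lee_fin normrM ler_piMr//.
  by have /andP[b0 b1] := boxbump_itv l' u' j x; rewrite ger0_norm.
have [_ _ c] := dominated_convergence mB mdj md cdj (integrable_abse idB) bdj.
have E : (fun j => \int[vol]_(x in box l' u') dj j x)%E = cst 0%E.
  by apply/funext => j; exact: i0.
by move: c; rewrite E => /cvg_lim <- //; rewrite lim_cst.
Qed.

End test_functions.

(** * Weak derivatives and the space H^1 *)

Section sobolev_spaces.
Context {R : realType} {n : nat}.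
Local Notation Rn := 'rV[R]_n.
Local Notation vol := (lebesgue_rV R n).
Implicit Types (U K : set Rn) (p q u w d e f : Rn -> R) (i : 'I_n).

Lemma continuous_L1loc U p : continuous p -> L1loc U p.
Proof.
move=> cp K cK KU; have mK := compact_measurable_rV cK.
have [M hM] := compact_continuous_bounded cK (continuous_subspaceT cp).
rewrite (_ : p = fun x => cst 1 x * p x); last by apply/funext => x;
  rewrite mul1r.
apply: (@integrable_mul_bounded _ _ _ _ _ (cst 1) _ M) => //.
  apply/integrableP; split; first exact/measurable_EFinP/measurable_cst.
  rewrite (eq_integral (cst 1%E)); last by move=> x _ /=; rewrite normr1.
  by rewrite integral_cst// mul1e; exact: compact_finite_vol.
exact: continuous_measurable_rV.
Qed.

Lemma test_sqint U p : open U -> test_function U p -> sqint vol U p.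
Proof.
move=> oU tp; have cp := test_continuous tp.
split; first by apply: continuous_measurable_rV => //;
  exact: open_measurable_rV.
rewrite (_ : _ \o _ = EFin \o (fun x => p x * p x)); last first.
  by apply/funext => x /=; rewrite expr2.
by apply: L1loc_test => //; exact: continuous_L1loc.
Qed.

(** The integrand is the i-th derivative of [p * rho]. Compact support of [p] makes this product
    vanish outside a box, whatever [rho] does, so its derivative can be integrated over the whole
    space. *)
Lemma ibp_test U i p (rho drho : Rn -> R) : open U -> test_function U p ->
  continuous rho -> continuous drho ->
  (forall x, is_derive x (std_basis i) rho (drho x)) ->
  \int[vol]_(x in U) (partial i p x * rho x + p x * drho x) = 0.
Proof.
move=> oU /[dup] tp [sp [K [cK KU p0]]] cr cdr dr.
have dp0 x : ~ K x -> partial i p x = 0 by exact: partial_out.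
have [l [u Kb]] := compact_box cK.
have -> : \int[vol]_(x in U) (partial i p x * rho x + p x * drho x) =
    \int[vol]_(x in setT) (partial i p x * rho x + p x * drho x).
  apply/esym/Rintegral_support => // x _ nU.
  by rewrite p0 ?dp0 ?mul0r ?add0r// => /KU.
have D x : is_derive x (std_basis i) (fun x => p x * rho x)
    (partial i p x * rho x + p x * drho x).
  apply: (is_derive_eq (is_deriveM (smooth_derive i x sp) (dr x))).
  by rewrite /GRing.scale /= addrC mulrC.
rewrite /Rintegral (@integral_partial_support _ _ i l u (fun x =>
  p x * rho x) _ _ D)//.
- move=> x; apply: (@continuousD _ _ _ (fun x => partial i p x * rho x)
    (fun x => p x * drho x)); apply: continuousM.
  + exact: test_continuous (test_partial i tp) x.
  + exact: cr.
  + exact: test_continuous tp x.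
  + exact: cdr.
- by move=> x nb; rewrite p0 ?mul0r// => /Kb.
- by move=> x nb; rewrite p0 ?dp0 ?mul0r ?add0r// => /Kb /box_cbox.
Qed.

Lemma test_weak_partial U i p : open U -> test_function U p ->
  weak_partial U i p (partial i p).
Proof.
move=> oU tp; have cp := test_continuous tp.
have cdp := test_continuous (test_partial i tp).
split; [exact: continuous_L1loc|exact: continuous_L1loc|move=> q tq].
have mU := open_measurable_rV oU.
have cdq := test_continuous (test_partial i tq).
have := ibp_test oU tq cp cdp (fun x => smooth_derive i x tp.1).
rewrite RintegralD//; last 2 first.
- rewrite (_ : _ \o _ = EFin \o (fun x => p x * partial i q x)).
    by apply: L1loc_test; [|exact: continuous_L1loc|exact: test_partial].
  by apply/funext => x /=; rewrite mulrC.
- apply: L1loc_test => //; last exact: test_partial.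
  by apply: continuous_L1loc; exact: test_continuous tq.
move/eqP; rewrite addr_eq0 => /eqP E.
under eq_Rintegral do rewrite mulrC.
rewrite E; congr (- _); apply: eq_Rintegral => x _; exact: mulrC.
Qed.

Lemma L1loc_lin U u w (a b : R) : L1loc U u -> L1loc U w ->
  L1loc U (fun x => a * u x + b * w x).
Proof.
move=> lu lw K cK KU; have mK := compact_measurable_rV cK.
rewrite (_ : _ \o _ = fun x => ((a * u x)%:E + (b * w x)%:E)%E)//.
by apply: integrableD => //; apply: integrable_scale => //;
  [exact: lu|exact: lw].
Qed.

Lemma Rintegral_lin (D : set Rn) f e (a b : R) : measurable D ->
  vol.-integrable D (EFin \o f) -> vol.-integrable D (EFin \o e) ->
  \int[vol]_(x in D) (a * f x + b * e x) =
  a * \int[vol]_(x in D) f x + b * \int[vol]_(x in D) e x.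
Proof.
by move=> mD fi ei; rewrite RintegralD ?RintegralZl//; exact: integrable_scale.
Qed.

Lemma weak_partial_lin U i u w d e (a b : R) : open U ->
  weak_partial U i u d -> weak_partial U i w e ->
  weak_partial U i (fun x => a * u x + b * w x) (fun x => a * d x + b * e x).
Proof.
move=> oU [lu ld ud] [lw le we]; split; [exact: L1loc_lin|exact: L1loc_lin|].
have mU := open_measurable_rV oU.
move=> q tq; have tdq := test_partial i tq.
under eq_Rintegral do rewrite mulrDl -!mulrA.
under [in RHS]eq_Rintegral do rewrite mulrDl -!mulrA.
rewrite (@Rintegral_lin _ (fun x => u x * partial i q x) (fun x =>
  w x * partial i q x))//;
  try exact: L1loc_test.
rewrite (@Rintegral_lin _ (fun x => d x * q x) (fun x => e x * q x))//;
  try exact: L1loc_test.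
by rewrite ud// we// !mulrN opprD.
Qed.

Lemma weak_partial_unique U i u d e : open U ->
  weak_partial U i u d -> weak_partial U i u e -> ae_eq vol U d e.
Proof.
move=> oU [_ ld ud] [_ le ue].
have mU := open_measurable_rV oU.
have := @fundamental_lemma _ _ U (fun x =>
  1 * d x + (-1) * e x) oU (L1loc_lin 1 (-1) ld le).
move=> /(_ _)/= h.
have : {ae vol, forall x, U x -> 1 * d x + (-1) * e x = 0}.
  apply: h => q tq; under eq_Rintegral do rewrite mulrDl -!mulrA.
  rewrite (@Rintegral_lin _ (fun x => d x * q x) (fun x => e x * q x))//;
    try exact: L1loc_test.
  rewrite mul1r mulN1r; apply/eqP; rewrite subr_eq0; apply/eqP/oppr_inj.
  by rewrite -ud// ue.
by apply: filterS => x hx Ux; have := hx Ux; lra.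
Qed.

Lemma wpartialP U i u d : weak_partial U i u d ->
  weak_partial U i u (wpartial U i u).
Proof. by move=> ud; apply: xgetPex; exists d. Qed.

Lemma wpartial_ae U i u d : open U -> weak_partial U i u d ->
  ae_eq vol U (wpartial U i u) d.
Proof. by move=> oU ud; apply: (weak_partial_unique oU _ ud);
  exact: (wpartialP ud). Qed.

Lemma L2P U f : measurable U -> L2 U f <-> sqint vol U f.
Proof.
move=> mU; rewrite /L2 /sqint.
have E : EFin \o (fun x => (f \_ U) x ^+ 2) = (EFin \o (fun x =>
  f x ^+ 2)) \_ U.
  by apply/funext => x; rewrite /= !patchE; case: ifP => //= _; rewrite expr0n.
split=> [h|[mf fi]].
  split; last by apply/(integrable_mkcond _ mU); rewrite -E;
    exact: Lfun2_integrable_sqr.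
  move: h; rewrite inE => /andP[]; rewrite inE => mf _.
  exact/measurable_restrictT.
have mfU : measurable_fun setT (f \_ U) by apply/(measurable_restrictT _ mU).
rewrite inE; apply/andP; split; rewrite inE//=.
rewrite /finite_norm unlock /=; apply: poweR_lty.
move/(integrable_mkcond _ mU) : fi; rewrite -E => /integrableP[_].
apply: le_lt_trans; rewrite le_eqVlt; apply/orP; left; apply/eqP.
apply: eq_integral => x _ /=.
by rewrite powR_mulrn// normrX.
Qed.

Lemma sqint_L1loc U f : measurable U -> sqint vol U f -> L1loc U f.
Proof.
move=> mU [mf fi] K cK KU; have mK := compact_measurable_rV cK.
have sK : sqint vol K f.
  by split; [exact: measurable_funS mf|exact: integrableS fi].
have s1 : sqint vol K (cst 1).
  split; first exact: measurable_cst.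
  apply/integrableP; split; first by apply/measurable_EFinP;
    exact: measurable_funX.
  rewrite (eq_integral (cst 1%E)); last by move=> x _ /=; rewrite expr1n normr1.
  by rewrite integral_cst// mul1e; exact: compact_finite_vol.
have := sqintM mK sK s1.
by under [X in integrable _ _ (_ \o X) -> _]eq_fun do rewrite /cst mulr1.
Qed.

Lemma H1_sqint U u : open U -> H1 U u -> sqint vol U u.
Proof. by move=> oU [h _]; apply/(L2P _ (open_measurable_rV oU)). Qed.

Lemma H1_wpartial U u i : open U -> H1 U u ->
  weak_partial U i u (wpartial U i u).
Proof. by move=> oU [_ /(_ i)[d [ud _]]]; exact: wpartialP ud. Qed.

Lemma H1_wpartial_sqint U u i : open U -> H1 U u ->
  sqint vol U (wpartial U i u).
Proof.
move=> oU [_ /(_ i)[d [ud d2]]]; have mU := open_measurable_rV oU.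
apply: (@sqint_ae _ _ _ _ U d) => //; first exact/(L2P _ mU).
  by apply: L1loc_measurable => //; have [] := wpartialP ud.
exact: ae_eq_sym (wpartial_ae oU ud).
Qed.

Lemma H1_intro U u (d : 'I_n -> Rn -> R) : open U -> sqint vol U u ->
  (forall i, weak_partial U i u (d i) /\ sqint vol U (d i)) -> H1 U u.
Proof.
move=> oU su hd; have mU := open_measurable_rV oU; split;
  first exact/(L2P _ mU).
by move=> i; exists (d i); have [h1 h2] := hd i; split => //; exact/(L2P _ mU).
Qed.

Lemma H1_lin U u w (a b : R) : open U -> H1 U u -> H1 U w ->
  H1 U (fun x => a * u x + b * w x).
Proof.
move=> oU hu hw; have mU := open_measurable_rV oU.
apply: (@H1_intro _ _ (fun i x =>
  a * wpartial U i u x + b * wpartial U i w x)) => //.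
  by apply: sqint_lin => //; exact: H1_sqint.
move=> i; split; last by apply: sqint_lin => //; exact: H1_wpartial_sqint.
by apply: weak_partial_lin => //; exact: H1_wpartial.
Qed.

Lemma test_H1 U p : open U -> test_function U p -> H1 U p.
Proof.
move=> oU tp; apply: (@H1_intro _ _ (fun i => partial i p)) => //.
  exact: test_sqint.
by move=> i; split; [exact: test_weak_partial|apply: test_sqint => //;
  exact: test_partial].
Qed.

End sobolev_spaces.

Lemma big_option (R : nmodType) (I : finType) (F : option I -> R) :
  \sum_o F o = F None + \sum_i F (Some i).
Proof.
rewrite (bigD1 None)//=; congr (_ + _).
rewrite (reindex_omap Some id) /=; last by case.
by apply: eq_bigl => i; rewrite eqxx.
Qed.

(** Induction on a list of [m] terms with sum [S]: the cross term in the square of [t + S] is at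
    most [2 * m * C], so the bound grows from [m ^+ 2 * C] to [(m + 1) ^+ 2 * C]. *)
Lemma sqr_sum_le (R : realFieldType) (I : finType) (t : I -> R) (C : R) :
  (forall i, t i ^+ 2 <= C) -> (\sum_i t i) ^+ 2 <= #|I|%:R ^+ 2 * C.
Proof.
move=> tC.
have H (s : seq I) : (\sum_(i <- s) t i) ^+ 2 <= (size s)%:R ^+ 2 * C.
  elim: s => [|i s IH]; first by rewrite big_nil /= expr0n /= mul0r.
  have C0 : 0 <= C by apply: le_trans (tC i); exact: sqr_ge0.
  rewrite big_cons /= -natr1; set S := \sum_(j <- s) t j in IH *.
  set m : R := (size s)%:R in IH *; have m0 : 0 <= m by exact: ler0n.
  have [m1|m1] := eqVneq m 0.
    have S0 : S = 0.
      by apply/eqP; rewrite -sqrf_eq0 eq_le sqr_ge0 andbT; move: IH;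
        rewrite m1 expr0n mul0r.
    by rewrite S0 m1 addr0 add0r expr1n mul1r.
  have mp : 0 < m by rewrite lt_neqAle eq_sym m1.
  have h1 : 0 <= (S - m * t i) ^+ 2 by exact: sqr_ge0.
  have h2 := tC i.
  (* Expanding [0 <= (S - m t) ^+ 2] bounds [2 m t S] by [2 m ^+ 2 C]; dividing by [m] requires the
     case of an empty list to be apart. *)
  have h3 : 2 * t i * S <= 2 * m * C.
    rewrite -(ler_pM2l mp).
    have : m * (m * t i ^+ 2) <= m * (m * C) by rewrite !ler_wpM2l.
    nra.
  nra.
by rewrite -big_enum /= cardE; exact: H.
Qed.

(** * The spaces H^1 and H^1_0 *)

Section jets.
Context {R : realType} {n : nat}.
Local Notation Rn := 'rV[R]_n.
Local Notation vol := (lebesgue_rV R n).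
Implicit Types (U K : set Rn) (p q u w d f g : Rn -> R) (i : 'I_n) (e : R).
Implicit Types (o : option 'I_n) (G : option 'I_n -> Rn -> R).

(* [None] stands for the function itself and [Some i] for its i-th weak
   derivative: the H^1 norm and the functionals [F_0 u + F_i d_i u] become sums
   over [option 'I_n]. *)
Definition jet U u o : Rn -> R := if o is Some i then wpartial U i u else u.

Lemma jet_sqint U u o : open U -> H1 U u -> sqint vol U (jet U u o).
Proof. by case: o => [i|] oU hu;
  [exact: H1_wpartial_sqint|exact: H1_sqint]. Qed.

Lemma jet_lin U u w (a b : R) o : open U -> H1 U u -> H1 U w ->
  ae_eq vol U (jet U (fun x => a * u x + b * w x) o)
    (fun x => a * jet U u o x + b * jet U w o x).
Proof.
move=> oU hu hw; case: o => [i|]; last exact: ae_eq_refl.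
by apply: wpartial_ae => //; apply: weak_partial_lin => //; exact: H1_wpartial.
Qed.

Lemma jet_test U p i : open U -> test_function U p ->
  ae_eq vol U (jet U p (Some i)) (partial i p).
Proof. by move=> oU tp; apply: wpartial_ae => //; exact: test_weak_partial. Qed.

Lemma Rintegral_sum (I : Type) (D : set Rn) (s : seq I) (F : I -> Rn -> R) :
  measurable D -> (forall i : I, vol.-integrable D (EFin \o F i)) ->
  vol.-integrable D (EFin \o (fun x => \sum_(i <- s) F i x)) /\
  \int[vol]_(x in D) (\sum_(i <- s) F i x) = \sum_(i <- s) \int[vol]_(x in D)
    F i x.
Proof.
move=> mD iF; elim: s => [|i s [IH1 IH2]].
  rewrite big_nil; under eq_Rintegral do rewrite big_nil; split.
    under [X in _ \o X]eq_fun do rewrite big_nil.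
    exact: integrable0.
  by rewrite Rintegral_cst// mul0r.
rewrite big_cons -IH2; under eq_Rintegral do rewrite big_cons.
split; last by rewrite RintegralD//.
under [X in _ \o X]eq_fun do rewrite big_cons.
exact: (integrableD mD (iF i) IH1).
Qed.

Definition H1sq U u : R := \sum_o \int[vol]_(x in U) (jet U u o x ^+ 2).

Lemma H1sq_ge0 U u : 0 <= H1sq U u.
Proof. by apply: sumr_ge0 => o _; apply: Rintegral_ge0 => x _;
  exact: sqr_ge0. Qed.

Lemma H1normE U u : open U -> H1 U u -> H1norm U u = Num.sqrt (H1sq U u).
Proof.
move=> oU hu; have mU := open_measurable_rV oU; congr Num.sqrt.
rewrite /H1sq; have [_ <-] := @Rintegral_sum _ U (index_enum (option 'I_n))
  (fun o x => jet U u o x ^+ 2) mU (fun o => (jet_sqint o oU hu).2).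
apply: eq_Rintegral => x _; rewrite big_option /=; congr (_ + _).
by apply: eq_bigr => i _; rewrite !mxE expr2.
Qed.

Lemma H1sqE U u : open U -> H1 U u -> H1sq U u = H1norm U u ^+ 2.
Proof. by move=> oU hu; rewrite H1normE// sqr_sqrtr// H1sq_ge0. Qed.

Definition jetform U G u : R := \sum_o \int[vol]_(x in U) (G o x * jet U u o x).

Lemma jetform_lin U G u w (a b : R) : open U -> (forall o, sqint vol U (G o)) ->
  H1 U u -> H1 U w ->
  jetform U G (fun x => a * u x + b * w x) = a * jetform U G u + b * jetform U
    G w.
Proof.
move=> oU sG hu hw; have mU := open_measurable_rV oU.
rewrite /jetform !mulr_sumr -big_split /=; apply: eq_bigr => o _.
have hl := H1_lin a b oU hu hw.
have iu := sqintM mU (sG o) (jet_sqint o oU hu).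
have iw := sqintM mU (sG o) (jet_sqint o oU hw).
rewrite -Rintegral_lin//; apply: ae_eq_Rintegral => //.
- apply: measurable_funM; first exact: (sG o).1.
  exact: (jet_sqint o oU hl).1.
- apply: measurable_funD; apply: measurable_funM => //; apply: measurable_funM.
  + exact: (sG o).1.
  + exact: (jet_sqint o oU hu).1.
  + exact: (sG o).1.
  + exact: (jet_sqint o oU hw).1.
- have := jet_lin a b o oU hu hw; apply: filterS => x h Ux; rewrite h//; ring.
Qed.

Lemma jetform_bound U G : open U -> (forall o, sqint vol U (G o)) ->
  exists2 C, 0 <= C & forall u, H1 U u -> jetform U G u ^+ 2 <= C * H1sq U u.
Proof.
move=> oU sG; have mU := open_measurable_rV oU.
pose A := \sum_o \int[vol]_(x in U) (G o x ^+ 2).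
have A0 o : 0 <= \int[vol]_(x in U) (G o x ^+ 2).
  by apply: Rintegral_ge0 => x _; exact: sqr_ge0.
exists (#|{: option 'I_n}|%:R ^+ 2 * A).
  by rewrite mulr_ge0 ?sqr_ge0//; exact: sumr_ge0.
move=> u hu; rewrite -mulrA; apply: sqr_sum_le => o.
apply: le_trans (Rintegral_cauchy_schwarz mU (sG o) (jet_sqint o oU hu)) _.
have J0 o' : 0 <= \int[vol]_(x in U) (jet U u o' x ^+ 2).
  by apply: Rintegral_ge0 => x _; exact: sqr_ge0.
apply: ler_pM => //.
- by rewrite /A (bigD1 o)//= lerDl; apply: sumr_ge0.
- by rewrite /H1sq (bigD1 o)//= lerDl; apply: sumr_ge0.
Qed.

Lemma H10_H1 U u : H10 U u -> H1 U u.
Proof. by case. Qed.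

Lemma H10P U u : open U -> H1 U u -> H10 U u <->
  forall e, 0 < e -> exists2 p, test_function U p & H1sq U (fun x =>
    u x - p x) <= e.
Proof.
move=> oU hu; split=> [[_ [psi [tpsi cpsi]]] e e0|h].
  have e0' : 0 < Num.sqrt e by rewrite sqrtr_gt0.
  move/cvgrPdist_le/(_ _ e0') : cpsi => [N _ /(_ N (leqnn N)) /=].
  rewrite sub0r normrN => hN; exists (psi N) => //.
  have hd : H1 U (u \- psi N).
    have := H1_lin 1 (-1) oU hu (test_H1 oU (tpsi N)).
    by under [X in H1 U X -> _]eq_fun do rewrite mul1r mulN1r.
  rewrite (H1sqE oU hd) -(real_normK (num_real (H1norm _ _))).
  by rewrite -(sqr_sqrtr (ltW e0)) lerXn2r// nnegrE.
split=> //.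
have [psi hpsi] : {psi : nat -> Rn -> R & forall k, test_function U (psi k) /\
    H1sq U (fun x => u x - psi k x) <= k.+1%:R^-1 ^+ 2}.
  apply: (@choice _ _ (fun (k : nat) p => test_function U p /\
    H1sq U (fun x => u x - p x) <= k.+1%:R^-1 ^+ 2)) => k.
  have k0 : 0 < k.+1%:R^-1 ^+ 2 :> R by rewrite exprn_gt0// invr_gt0.
  by have [p tp hp] := h _ k0; exists p.
exists psi; split=> [k|]; first by have [] := hpsi k.
apply: (@squeeze_cvgr _ _ _ _ (cst 0) (fun k => k.+1%:R^-1)); last 2 first.
- exact: cvg_cst.
- exact: cvg_harmonic.
apply: nearW => k; rewrite sqrtr_ge0/=.
have [tk hk] := hpsi k.
have hd : H1 U (u \- psi k).
  have := H1_lin 1 (-1) oU hu (test_H1 oU tk).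
  by under [X in H1 U X -> _]eq_fun do rewrite mul1r mulN1r.
rewrite H1normE// -[leRHS]ger0_norm ?invr_ge0// -sqrtr_sqr.
exact: ler_wsqrtr.
Qed.

(** For a test function [p], the value at [u] equals the value at [u - p], whose square is at most
    [C] times [H1sq] of [u - p]. The tolerance is [e / (C + 1)] because [C] may be zero. *)
Lemma jetform_density U G : open U -> (forall o, sqint vol U (G o)) ->
  (forall p, test_function U p -> jetform U G p = 0) ->
  forall u, H10 U u -> jetform U G u = 0.
Proof.
move=> oU sG G0 u /[dup] /H10_H1 hu /(H10P oU hu) h.
have [C C0 hC] := jetform_bound oU sG.
apply/eqP; rewrite -sqrf_eq0 eq_le sqr_ge0 andbT.
apply/ler_addgt0Pr => e e0; rewrite add0r.
have [|p tp hp] := h (e / (C + 1)); first by rewrite divr_gt0// ltr_wpDl.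
have hd : H1 U (fun x => 1 * u x + (-1) * p x) by apply: H1_lin => //;
  exact: test_H1.
have := hC _ hd; rewrite jetform_lin//; last exact: test_H1.
rewrite (G0 _ tp) mulr0 addr0 mul1r => /le_trans; apply.
have -> : (fun x => 1 * u x + (-1) * p x) = (fun x => u x - p x).
  by apply/funext => x; rewrite mul1r mulN1r.
apply: le_trans (ler_wpM2l C0 hp) _.
by rewrite mulrA ler_pdivrMr ?ltr_wpDl// [leLHS]mulrC ler_pM2l// lerDl ler01.
Qed.

(** This plays the role of the triangle inequality for squared norms; it comes from
    [0 <= (a s - b t) ^+ 2] applied to each component of the jets. *)
Lemma H1sq_lin_le U u w (a b : R) : open U -> H1 U u -> H1 U w ->
  H1sq U (fun x => a * u x + b * w x) <=
  2 * a ^+ 2 * H1sq U u + 2 * b ^+ 2 * H1sq U w.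
Proof.
move=> oU hu hw; have mU := open_measurable_rV oU.
rewrite /H1sq !mulr_sumr -big_split /=; apply: ler_sum => o _.
have [mu iu] := jet_sqint o oU hu; have [mw iw] := jet_sqint o oU hw.
have [ml il] := sqint_lin a b mU (jet_sqint o oU hu) (jet_sqint o oU hw).
rewrite -Rintegral_lin//.
apply: (@le_trans _ _ (\int[vol]_(x in U) ((a * jet U u o x + b * jet U w o x)
  ^+ 2))).
  rewrite le_eqVlt; apply/orP; left; apply/eqP; apply: ae_eq_Rintegral => //.
  - by apply: measurable_funX; exact: (jet_sqint o oU (H1_lin a b oU hu hw)).1.
  - exact: measurable_funX.
  - by have := jet_lin a b o oU hu hw; apply: filterS => x h Ux; rewrite h.
apply: le_Rintegral => //.
  rewrite (_ : _ \o _ = fun x =>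
    ((2 * a ^+ 2 * jet U u o x ^+ 2)%:E + (2 * b ^+ 2 * jet U w o x ^+
      2)%:E)%E)//.
  by apply: integrableD => //; exact: integrable_scale.
by move=> x _; have := sqr_ge0 (a * jet U u o x - b * jet U w o x); nra.
Qed.

Lemma H10_lin U u w (a b : R) : open U -> H10 U u -> H10 U w ->
  H10 U (fun x => a * u x + b * w x).
Proof.
move=> oU hu hw; have [hu1 hw1] := (H10_H1 hu, H10_H1 hw).
apply/(H10P oU (H1_lin a b oU hu1 hw1)) => e e0.
pose c := 2 * a ^+ 2 + 2 * b ^+ 2 + 1.
have c0 : 0 < c by have := sqr_ge0 a; have := sqr_ge0 b; rewrite /c; lra.
have ec : 0 < e / c by exact: divr_gt0.
have [p tp hp] := (H10P oU hu1).1 hu _ ec.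
have [q tq hq] := (H10P oU hw1).1 hw _ ec.
exists (fun x => a * p x + b * q x); first exact: test_lin.
have hd v r : H1 U v -> test_function U r -> H1 U (fun x => v x - r x).
  move=> hv tr; have := H1_lin 1 (-1) oU hv (test_H1 oU tr).
  by under [X in H1 U X -> _]eq_fun do rewrite mul1r mulN1r.
rewrite (_ : (fun x => _) = (fun x => a * (u x - p x) + b * (w x - q x)));
  last first.
  by apply/funext => x; ring.
apply: le_trans (H1sq_lin_le a b oU (hd _ _ hu1 tp) (hd _ _ hw1 tq)) _.
have a0 : 0 <= 2 * a ^+ 2 by rewrite mulr_ge0 ?sqr_ge0.
have b0 : 0 <= 2 * b ^+ 2 by rewrite mulr_ge0 ?sqr_ge0.
apply: le_trans (lerD (ler_wpM2l a0 hp) (ler_wpM2l b0 hq)) _.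
rewrite -mulrDl mulrA ler_pdivrMr// [leLHS]mulrC ler_pM2l// /c; lra.
Qed.

Lemma test_H10 U p : open U -> test_function U p -> H10 U p.
Proof.
move=> oU tp; apply/(H10P oU (test_H1 oU tp)) => e e0; exists p => //.
(* The chosen weak derivative of the zero function need not be zero everywhere. Written as a
   combination of [p] with coefficients 0, the difference has [H1sq] bounded by 0. *)
rewrite (_ : (fun x => _) = (fun x => 0 * p x + 0 * p x)); last first.
  by apply/funext => x; rewrite subrr; ring.
apply: le_trans (H1sq_lin_le 0 0 oU (test_H1 oU tp) (test_H1 oU tp)) _.
by rewrite expr0n /= !mulr0 !mul0r addr0 ltW.
Qed.

End jets.

(** * Integration by parts and the Poincare inequality on H^1_0 *)

Lemma compact_closure_bounded {R : realType} {n : nat} (U : set 'rV[R]_n) :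
  bounded_set U -> compact (closure U).
Proof.
move=> bU; apply: bounded_closed_compact; last exact: closed_closure.
have [M [Mr hM]] := bU; exists M; split => // s Ms.
suff : closure U `<=` [set x | `|x| <= s] by [].
have cM : closed [set x : 'rV[R]_n | `|x| <= s].
  apply: (@preimage_closed _ _ (@Num.norm R 'rV[R]_n) [set y | y <= s]);
    last exact: closed_le.
  by move=> x _; exact: norm_continuous.
rewrite ((closure_id _).1 cM).
by apply: closure_subset => x Ux; exact: hM.
Qed.

Section integration_by_parts.
Context {R : realType} {n : nat}.
Local Notation Rn := 'rV[R]_n.
Local Notation vol := (lebesgue_rV R n).
Variables (U : set Rn) (i : 'I_n) (rho drho : Rn -> R).
Hypothesis oU : open U.
Hypothesis bU : bounded_set U.
Hypothesis cr : continuous rho.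
Hypothesis cdr : continuous drho.
Hypothesis dr : forall x, is_derive x (std_basis i) rho (drho x).
Implicit Types (u w p q : Rn -> R) (o : option 'I_n).

Lemma continuous_bounded_on (f : Rn -> R) : continuous f ->
  exists M, forall x, U x -> `|f x| <= M.
Proof.
move=> cf.
have [M hM] := compact_continuous_bounded (compact_closure_bounded bU)
  (continuous_subspaceT cf).
by exists M => x Ux; apply: hM; exact: subset_closure.
Qed.

(** For fixed [w], these are the coefficients of the functional sending [u] to the integral of the
    formal i-th derivative of [u w rho]: the product rule leaves [u] times the [None] coefficient
    plus the i-th derivative of [u] times [w rho]. *)
Definition ibp_weight w o x : R :=
  if o is Some j then (if j == i then w x * rho x else 0)
  else w x * drho x + wpartial U i w x * rho x.

Lemma ibp_weight_sqint w o : H1 U w -> sqint vol U (ibp_weight w o).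
Proof.
move=> hw; have mU := open_measurable_rV oU.
have [M hM] := continuous_bounded_on cr;
  have [N hN] := continuous_bounded_on cdr.
have mr := continuous_measurable_rV mU cr;
  have mdr := continuous_measurable_rV mU cdr.
case: o => [j|]; rewrite /ibp_weight.
  case: (j == i); first exact: (sqint_bounded mU (H1_sqint oU hw) mr hM).
  split; first exact: measurable_cst.
  by under [X in _ \o X]eq_fun do rewrite expr0n /=; exact: integrable0.
apply: sqintD => //; first exact: (sqint_bounded mU (H1_sqint oU hw) mdr hN).
exact: (sqint_bounded mU (H1_wpartial_sqint i oU hw) mr hM).
Qed.

Lemma ibp_weightE u w : H1 U u -> H1 U w -> jetform U (ibp_weight w) u =
  \int[vol]_(x in U) (u x * w x * drho x + wpartial U i u x * w x * rho x
    + u x * wpartial U i w x * rho x).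
Proof.
move=> hu hw; have mU := open_measurable_rV oU.
have h o := sqintM mU (ibp_weight_sqint o hw) (jet_sqint o oU hu).
rewrite /jetform big_option (bigD1 i)//= big1 ?addr0; last first.
  move=> j ji; rewrite (negbTE ji); under eq_Rintegral do rewrite mul0r.
  by rewrite Rintegral_cst// mul0r.
rewrite eqxx -RintegralD//; first last.
- by have := h (Some i); rewrite /= eqxx.
- exact: h None.
by apply: eq_Rintegral => x _; ring.
Qed.

(* The integral is symmetric in [u] and [w], so that the density of test
   functions can be used for one argument, then for the other. *)
Lemma ibp_H10 u w : H10 U u -> H10 U w ->
  \int[vol]_(x in U) (u x * w x * drho x + wpartial U i u x * w x * rho x
    + u x * wpartial U i w x * rho x) = 0.
Proof.
have mU := open_measurable_rV oU.
have tt p q : test_function U p -> test_function U q ->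
    jetform U (ibp_weight q) p = 0.
  move=> tp tq; have [hp hq] := (test_H1 oU tp, test_H1 oU tq).
  rewrite ibp_weightE//.
  (* For two test functions, [q * rho] serves as the smooth weight against [p]. *)
  have D x : is_derive x (std_basis i) (fun x => q x * rho x)
      (partial i q x * rho x + q x * drho x).
    apply: (is_derive_eq (is_deriveM (smooth_derive i x tq.1) (dr x))).
    by rewrite /GRing.scale /= addrC mulrC.
  have cq := test_continuous tq; have cdq := test_continuous (test_partial i
    tq).
  have c1 : continuous (fun x => q x * rho x).
    by move=> x; apply: continuousM; [exact: cq|exact: cr].
  have c2 : continuous (fun x => partial i q x * rho x + q x * drho x).
    move=> x; apply: (@continuousD _ _ _ (fun x => partial i q x * rho x)
      (fun x => q x * drho x)); apply: continuousM;
      [exact: cdq|exact: cr|exact: cq|exact: cdr].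
  have := ibp_test oU tp c1 c2 D => <-.
  apply: ae_eq_Rintegral => //.
  - have mp := (H1_sqint oU hp).1; have mq := (H1_sqint oU hq).1.
    have mdp := (H1_wpartial_sqint i oU hp).1.
    have mdq := (H1_wpartial_sqint i oU hq).1.
    have mr := continuous_measurable_rV mU cr.
    have mdr := continuous_measurable_rV mU cdr.
    by apply: measurable_funD; [apply: measurable_funD|];
      apply: measurable_funM => //; apply: measurable_funM.
  - apply: measurable_funD; apply: measurable_funM;
    apply: continuous_measurable_rV => //.
    + exact: test_continuous (test_partial i tp).
    + exact: test_continuous tp.
  - have := jet_test i oU tq; have := jet_test i oU tp;
    apply: filterS2 => x h1 h2 Ux.
    rewrite /= in h1 h2; rewrite h1// h2//; ring.
have ht u' q : H10 U u' -> test_function U q -> jetform U (ibp_weight q) u' = 0.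
  move=> hu tq; apply: (jetform_density oU _ _ hu).
    by move=> o; apply: ibp_weight_sqint; exact: test_H1.
  by move=> p tp; exact: tt.
move=> hu hw; have [hu1 hw1] := (H10_H1 hu, H10_H1 hw).
rewrite -ibp_weightE//; apply: (jetform_density oU _ _ hu).
  by move=> o; exact: ibp_weight_sqint.
move=> p tp; have hp := test_H1 oU tp.
rewrite (ibp_weightE hp hw1); have := ht w p hw tp;
  rewrite (ibp_weightE hw1 hp) => E.
by rewrite -{}E; apply: eq_Rintegral => x _; ring.
Qed.

End integration_by_parts.

Section poincare.
Context {R : realType} {n : nat}.
Local Notation Rn := 'rV[R]_n.
Local Notation vol := (lebesgue_rV R n).

(* Integration by parts with the weight [x_i] gives
   [\int u ^+ 2 = - 2 \int x_i u d_i u]. *)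
Lemma poincare (U : set Rn) (i : 'I_n) : open U -> bounded_set U ->
  exists2 C, 0 <= C & forall u, H10 U u ->
    \int[vol]_(x in U) (u x ^+ 2) <= C * \int[vol]_(x in U) (wpartial U i u x
      ^+ 2).
Proof.
move=> oU bU; have mU := open_measurable_rV oU.
pose rho (x : Rn) := x ord0 i.
have cr : continuous rho by exact: coord_continuous.
have cd : continuous (cst 1 : Rn -> R) by exact: cst_continuous.
have dr x : is_derive x (std_basis i : Rn) rho (cst 1 x).
  have E : rho \o (fun t : R => setc x i t) = id.
    by apply/funext => t; rewrite /= /rho mxE eqxx.
  have := is_derive_id (x ord0 i) (1 : R); rewrite -E.
  have := @is_derive_line _ _ _ _ rho (fun t : R =>
    setc x i t) (std_basis i) (x ord0 i) 1 1.
  rewrite setc_id => h /h; apply => t.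
  by rewrite -[X in _ = _ + X](setc_id x i) -setc_line /GRing.scale /= mulr1.
have [M hM] := continuous_bounded_on bU cr.
have M0 : 0 <= M ^+ 2 by exact: sqr_ge0.
exists (4 * M ^+ 2) => [|u hu]; first by rewrite mulr_ge0.
have hu1 := H10_H1 hu; have [mu iu] := H1_sqint oU hu1.
have sdu := H1_wpartial_sqint i oU hu1.
have mr := continuous_measurable_rV mU cr.
have sr := sqint_bounded mU sdu mr hM.
have iur := sqintM mU (H1_sqint oU hu1) sr.
have := ibp_H10 oU bU cr cd dr hu hu.
set I := \int[vol]_(x in U) (u x ^+ 2).
set D := \int[vol]_(x in U) (wpartial U i u x ^+ 2).
set P := \int[vol]_(x in U) (u x * (wpartial U i u x * rho x)).
have -> : \int[vol]_(x in U) (u x * u x * cst 1 x + wpartial U i u x * u x *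
  rho x
    + u x * wpartial U i u x * rho x) = 1 * I + 2 * P.
  by rewrite -Rintegral_lin//; apply: eq_Rintegral => x _ /=; ring.
move=> IP.
have D0 : 0 <= D by apply: Rintegral_ge0 => x _; exact: sqr_ge0.
have I0 : 0 <= I by apply: Rintegral_ge0 => x _; exact: sqr_ge0.
have PI : P ^+ 2 <= I * (M ^+ 2 * D).
  apply: le_trans (Rintegral_cauchy_schwarz mU (H1_sqint oU hu1) sr) _.
  apply: ler_wpM2l => //; rewrite -RintegralZl//; last exact: sdu.2.
  apply: le_Rintegral => //; first exact: sr.2.
    exact: (integrable_scale (M ^+ 2) mU sdu.2).
  move=> x Ux; rewrite exprMn mulrC ler_wpM2r ?sqr_ge0//.
  rewrite -(real_normK (num_real (rho x))) lerXn2r// ?nnegrE//.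
    by apply: le_trans (hM x Ux).
  exact: hM.
(* With [I = - 2 P], the bound on [P ^+ 2] reads [I ^+ 2 <= 4 M ^+ 2 D I], to be divided by [I];
   hence the constant [4 * M ^+ 2]. *)
have [->|In0] := eqVneq I 0; first by rewrite mulr_ge0// mulr_ge0.
have Ip : 0 < I by rewrite lt_neqAle eq_sym In0.
rewrite -(ler_pM2l Ip); nra.
Qed.

End poincare.

(** * The variational problem *)

Section riesz_sequence.
Context {R : realType} {X : Type}.
(** [lc a b x y] stands for [a x + b y] and [P] for a subspace of a mere type. No completeness of
    [P] is assumed, so a Cauchy sequence whose pairings tend to [L] takes the place of a vector
    representing [L]. *)
Variables (lc : R -> R -> X -> X -> X) (P : X -> Prop) (x0 : X).
Variables (B : X -> X -> R) (L : X -> R) (C : R).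
Hypothesis C0 : 0 <= C.
Hypothesis P0 : P x0.
Hypothesis Plc : forall a b x y, P x -> P y -> P (lc a b x y).
Hypothesis Blc : forall a b x y z, P x -> P y -> P z ->
  B (lc a b x y) z = a * B x z + b * B y z.
Hypothesis BC : forall x y, P x -> P y -> B x y = B y x.
Hypothesis B_ge0 : forall x, P x -> 0 <= B x x.
Hypothesis Llc : forall a b x y,
  P x -> P y -> L (lc a b x y) = a * L x + b * L y.
Hypothesis LB : forall x, P x -> L x ^+ 2 <= C * B x x.

Let J x := B x x - 2 * L x.

Let Blc2 a b x y : P x -> P y -> B (lc a b x y) (lc a b x y) =
  a ^+ 2 * B x x + 2 * a * b * B x y + b ^+ 2 * B y y.
Proof.
move=> Px Py; have Pl := Plc a b Px Py.
rewrite Blc// [B x _]BC// [B y _]BC// !Blc// [B y x]BC//; ring.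
Qed.

(* The energy [B x x - 2 L x] is bounded below; by the parallelogram identity
   its minimizing sequences are Cauchy. *)
Lemma riesz_sequence : exists x : nat -> X, [/\ forall k, P (x k),
  (forall e, 0 < e -> exists N, forall k l, (N <= k)%N -> (N <= l)%N ->
     B (lc 1 (-1) (x k) (x l)) (lc 1 (-1) (x k) (x l)) <= e) &
  forall y, P y -> B (x k) y @[k --> \oo] --> L y].
Proof.
have Jlb x : P x -> - C <= J x.
  move=> Px; have := LB Px; have b0 := B_ge0 Px; rewrite /J.
  move=> h; have : 2 * L x <= B x x + C.
    (* Otherwise [4 * L x ^+ 2] exceeds [(B x x + C) ^+ 2], which is at least [4 * C * B x x]. *)
    rewrite leNgt; apply/negP => h1.
    have c0 := C0.
    have h2 : 0 < (2 * L x - (B x x + C)) * (2 * L x + (B x x + C)).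
      by rewrite mulr_gt0//; lra.
    have := sqr_ge0 (B x x - C); nra.
  lra.
pose S := [set J x | x in P].
have S0 : S !=set0 by exists (J x0); exists x0.
have lbS : has_lbound S by exists (- C) => _ [x Px <-]; exact: Jlb.
have infS : has_inf S by split.
pose I := inf S.
have IJ x : P x -> I <= J x by move=> Px; apply: ge_inf => //; exists x.
have [x hx] : {x : nat -> X & forall k, P (x k) /\ J (x k) < I + k.+1%:R^-1}.
  apply: (@choice _ _ (fun (k : nat) x => P x /\ J x < I + k.+1%:R^-1)) => k.
  have k0 : 0 < k.+1%:R^-1 :> R by rewrite invr_gt0.
  by have [_ [y Py <-] hy] := inf_adherent k0 infS; exists y.
exists x; split.
- by move=> k; have [] := hx k.
- move=> e e0.
  have e4 : 0 < e / 4 by rewrite divr_gt0.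
  have [N _ hN] : \forall k \near \oo, k.+1%:R^-1 < e / 4.
    have /cvgrPdist_lt/(_ _ e4) := @cvg_harmonic R.
    by apply: filterS => k /=; rewrite sub0r normrN ger0_norm ?invr_ge0.
  exists N => k l Nk Nl; have [Pk Jk] := hx k; have [Pl Jl] := hx l.
  have hk : k.+1%:R^-1 < e / 4 by exact: hN.
  have hl : l.+1%:R^-1 < e / 4 by exact: hN.
  (* The midpoint has energy at least [I], and the parallelogram identity writes the form at
     [x k - x l] as [2 J (x k) + 2 J (x l)] minus four times the energy of the midpoint; this is
     less than [2 (e / 4 + e / 4) = e]. *)
  have := IJ _ (Plc (1/2) (1/2) Pk Pl); rewrite /J Blc2// Llc//.
  move: Jk Jl; rewrite /J Blc2//.
  move: (k.+1%:R^-1 : R) (l.+1%:R^-1 : R) hk hl => ek el.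
  rewrite !expr2; lra.
- move=> y Py.
  (* Near-minimality of [x k] compared with [x k + t y] gives [0 <= 1 / (k + 1) + 2 t (B (x k) y - L
     y) + t ^+ 2 B y y] for all [t]; the estimate is its discriminant. *)
  have key k : (B (x k) y - L y) ^+ 2 <= k.+1%:R^-1 * B y y.
    have [Pk Jk] := hx k; rewrite mulrC.
    suff : (B (x k) y - L y) ^+ 2 <= k.+1%:R^-1 * B y y by rewrite mulrC.
    apply: quadratic_ge0; first exact: B_ge0.
    move=> t; have := IJ _ (Plc 1 t Pk Py); rewrite /J Blc2// Llc//.
    move: Jk; rewrite /J; move: (k.+1%:R^-1 : R) => ek; nra.
  apply/cvgrPdist_lt => e e0.
  have b0 := B_ge0 Py.
  have eb : 0 < e ^+ 2 / (B y y + 1) by rewrite divr_gt0 ?exprn_gt0// ltr_wpDl.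
  have /cvgrPdist_lt/(_ _ eb) := @cvg_harmonic R.
  apply: filterS => k /=; rewrite sub0r normrN ger0_norm ?invr_ge0// => hk.
  have : (B (x k) y - L y) ^+ 2 < e ^+ 2.
    apply: le_lt_trans (key k) _.
    move: hk; rewrite ltr_pdivlMr ?ltr_wpDl//.
    have : 0 < k.+1%:R^-1 :> R by rewrite invr_gt0.
    move: (k.+1%:R^-1 : R) => ek; nra.
  rewrite distrC ltr_norml; move: (_ - _) => z z2.
  by apply/andP; split; nra.
Qed.

End riesz_sequence.

(** * Solvability of the elliptic form on H^1_0 *)

Section variational_problem.
Context {R : realType} {n : nat}.
Local Notation Rn := 'rV[R]_n.
Local Notation vol := (lebesgue_rV R n).
Implicit Types (u v w p q : Rn -> R) (o : option 'I_n) (i j : 'I_n).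
Implicit Types (G : option 'I_n -> Rn -> R).

Lemma sqint_cvg_pairing (D : set Rn) (f : (Rn -> R)^nat) (g h : Rn -> R) :
  measurable D -> (forall k, sqint vol D (f k)) -> sqint vol D g -> sqint vol
    D h ->
  (forall e, 0 < e -> exists N, forall k, (N <= k)%N ->
     \int[vol]_(x in D) ((g x - f k x) ^+ 2) <= e) ->
  \int[vol]_(x in D) (h x * f k x) @[k --> \oo] --> \int[vol]_(x in D) (h x *
    g x).
Proof.
move=> mD sf sg sh cf; apply/cvgrPdist_lt => e e0.
set H := \int[vol]_(x in D) (h x ^+ 2).
have H0 : 0 <= H by apply: Rintegral_ge0 => x _; exact: sqr_ge0.
have [|N hN] := cf (e ^+ 2 / (H + 1));
  first by rewrite divr_gt0 ?exprn_gt0// ltr_wpDl.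
exists N => // k /= /hN {}hN.
have sd := sqintB mD sg (sf k).
have := Rintegral_cauchy_schwarz mD sh sd.
rewrite -/H; set S := \int[vol]_(x in D) ((g x - f k x) ^+ 2) in hN *.
have -> : \int[vol]_(x in D) (h x * (g x - f k x)) =
    \int[vol]_(x in D) (h x * g x) - \int[vol]_(x in D) (h x * f k x).
  rewrite -RintegralB//; last 2 first.
  - exact: (sqintM mD sh sg).
  - exact: (sqintM mD sh (sf k)).
  by apply: eq_Rintegral => x _; rewrite mulrBr.
move: (_ - _) => z hz.
have S0 : 0 <= S by apply: Rintegral_ge0 => x _; exact: sqr_ge0.
have z2 : z ^+ 2 < e ^+ 2.
  move: hN; rewrite ler_pdivlMr ?ltr_wpDl// => hN.
  have [S1|S1] := eqVneq S 0.
    by apply: le_lt_trans hz _; rewrite S1 mulr0 exprn_gt0.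
  have : 0 < S by rewrite lt_neqAle eq_sym S1.
  nra.
by rewrite ltr_norml; apply/andP; split; nra.
Qed.

Variables (U : set Rn) (beta : Rn -> 'M[R]_n) (m : R) (K : 'I_n -> 'I_n -> R)
  (i0 : 'I_n).
Hypothesis oU : open U.
Hypothesis bU : bounded_set U.
Hypothesis beta_meas : forall i j, measurable_fun U (fun x => beta x i j).
Hypothesis beta_bounded : forall i j x, U x -> `|beta x i j| <= K i j.
Hypothesis beta_sym : forall x, U x -> (beta x)^T = beta x.
Hypothesis m_gt0 : 0 < m.
Hypothesis beta_elliptic : forall x, U x -> forall xi : Rn,
  m * dot xi xi <= dot (mulmxv (beta x) xi) xi.

Let mU : measurable U := open_measurable_rV oU.

Definition energy u w : R :=
  \int[vol]_(x in U) dot (mulmxv (beta x) (wgrad U u x)) (wgrad U w x).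

(** The coefficients that make [energy u] a [jetform]: the vector [beta grad u], with no zero-order
    part. *)
Definition flux u o x : R :=
  if o is Some i then \sum_j beta x i j * wpartial U j u x else 0.

Lemma sqint0 : sqint vol U (cst 0).
Proof.
split; first exact: measurable_cst.
by under [X in _ \o X]eq_fun do rewrite expr0n /=; exact: integrable0.
Qed.

Lemma flux_sqint u o : H1 U u -> sqint vol U (flux u o).
Proof.
move=> hu; case: o => [i|]; last exact: sqint0.
rewrite /flux (_ : (fun x => _) = \sum_j (fun x =>
  beta x i j * wpartial U j u x)).
  elim/big_ind : _ => [|f g sf sg|j _].
  - exact: sqint0.
  - exact: sqintD.
  - have := sqint_bounded mU (H1_wpartial_sqint j oU hu) (beta_meas i j)
    (@beta_bounded i j).
    by under [X in sqint _ _ X -> _]eq_fun do rewrite mulrC.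
by apply/funext => x; rewrite fct_sumE.
Qed.

Lemma energyE u w : H1 U u -> H1 U w -> energy u w = jetform U (flux u) w.
Proof.
move=> hu hw; rewrite /jetform.
have [_ <-] := @Rintegral_sum _ _ _ U (index_enum (option 'I_n))
  (fun o x => flux u o x * jet U w o x) mU
  (fun o => sqintM mU (flux_sqint o hu) (jet_sqint o oU hw)).
apply: eq_Rintegral => x _; rewrite big_option mul0r add0r /dot.
apply: eq_bigr => i _; rewrite !mxE; congr (_ * _).
by apply: eq_bigr => j _; rewrite !mxE.
Qed.

Lemma dot_mulmxvC (A : 'M[R]_n) (x y : Rn) : A^T = A ->
  dot (mulmxv A x) y = dot (mulmxv A y) x.
Proof.
move=> sA; rewrite /dot /mulmxv.
under eq_bigr do rewrite !mxE mulr_suml.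
under [RHS]eq_bigr do rewrite !mxE mulr_suml.
rewrite exchange_big; apply: eq_bigr => i _; apply: eq_bigr => j _.
by rewrite !mxE -[in LHS]sA mxE; ring.
Qed.

Lemma energyC u w : energy u w = energy w u.
Proof.
by apply: eq_Rintegral => x; rewrite inE => Ux; apply: dot_mulmxvC;
  exact: beta_sym.
Qed.

Lemma energy_ge u : H1 U u ->
  m * \sum_i \int[vol]_(x in U) (wpartial U i u x ^+ 2) <= energy u u.
Proof.
move=> hu.
have [h1 <-] := @Rintegral_sum _ _ _ U (index_enum 'I_n)
  (fun i x => wpartial U i u x ^+ 2) mU (fun i =>
    (H1_wpartial_sqint i oU hu).2).
have h2 : vol.-integrable U (EFin \o
    (fun x => dot (mulmxv (beta x) (wgrad U u x)) (wgrad U u x))).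
  have [h _] := @Rintegral_sum _ _ _ U (index_enum (option 'I_n))
    (fun o x => flux u o x * jet U u o x) mU
    (fun o => sqintM mU (flux_sqint o hu) (jet_sqint o oU hu)).
  rewrite [X in _ \o X](_ : _ =
    (fun x => \sum_(o : option 'I_n) flux u o x * jet U u o x))//.
  apply/funext => x; rewrite big_option mul0r add0r /dot.
  apply: eq_bigr => i _; rewrite !mxE; congr (_ * _).
  by apply: eq_bigr => j _; rewrite !mxE.
rewrite -RintegralZl//; apply: le_Rintegral => //.
  exact: integrable_scale.
move=> x Ux; apply: le_trans (beta_elliptic Ux _); rewrite le_eqVlt;
  apply/orP; left.
by apply/eqP; congr (_ * _); apply: eq_bigr => i _; rewrite !mxE expr2.
Qed.

(** The Poincare inequality in the single direction [i0] bounds the integral of [u ^+ 2] by [c]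
    times the squared gradient norm, and ellipticity bounds the latter by [energy u u / m]; hence
    the constant [(c + 1) / m]. *)
Lemma energy_coercive : exists2 C, 0 <= C &
  forall u, H10 U u -> H1sq U u <= C * energy u u.
Proof.
have [c c0 hc] := poincare i0 oU bU.
exists ((c + 1) / m); first by rewrite divr_ge0 ?addr_ge0// ltW.
move=> u hu; have := energy_ge (H10_H1 hu).
set S := \sum_i _ => hS; have S0 i : 0 <= \int[vol]_(x in U) (wpartial U i u x
  ^+ 2).
  by apply: Rintegral_ge0 => x _; exact: sqr_ge0.
have hi : \int[vol]_(x in U) (wpartial U i0 u x ^+ 2) <= S.
  by rewrite /S (bigD1 i0)//= lerDl; apply: sumr_ge0 => i _.
have -> : H1sq U u = \int[vol]_(x in U) (u x ^+ 2) + S by rewrite /H1sq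
  big_option.
rewrite mulrAC ler_pdivlMr//.
have h1 : \int[vol]_(x in U) (u x ^+ 2) <= c * S.
  by apply: le_trans (hc u hu) _; exact: ler_wpM2l.
have := ler_wpM2r (ltW m_gt0) h1; have := ler_wpM2l c0 hS.
move: hS; move: (energy u u) (Rintegral _ _ _) => E J; nra.
Qed.

Lemma jetform_linG G G' w (a b : R) : (forall o, sqint vol U (G o)) ->
  (forall o, sqint vol U (G' o)) -> H1 U w ->
  jetform U (fun o x => a * G o x + b * G' o x) w =
  a * jetform U G w + b * jetform U G' w.
Proof.
move=> sG sG' hw; rewrite /jetform !mulr_sumr -big_split /=;
  apply: eq_bigr => o _.
rewrite -Rintegral_lin//; last 2 first.
- exact: sqintM (sG o) (jet_sqint o oU hw).
- exact: sqintM (sG' o) (jet_sqint o oU hw).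
by apply: eq_Rintegral => x _; ring.
Qed.

Lemma energy_lin a b u w v : H1 U u -> H1 U w -> H1 U v ->
  energy (fun x => a * u x + b * w x) v = a * energy u v + b * energy w v.
Proof.
move=> hu hw hv; rewrite ![energy _ v]energyC !energyE//; last exact: H1_lin.
by rewrite jetform_lin// => o; exact: flux_sqint.
Qed.

(** The difference has zero energy, so coercivity makes its squared L^2 norm vanish. *)
Lemma variational_unique v w : H10 U v -> H10 U w ->
  (forall p, H10 U p -> energy v p = energy w p) -> ae_eq vol U v w.
Proof.
move=> hv hw E; have [hv1 hw1] := (H10_H1 hv, H10_H1 hw).
have [C C0 hC] := energy_coercive.
have hd := H10_lin 1 (-1) oU hv hw; have hd1 := H10_H1 hd.
have := hC _ hd; rewrite energy_lin// E// mul1r mulN1r subrr mulr0 => h.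
have i0' : \int[vol]_(x in U) ((1 * v x + -1 * w x) ^+ 2) = 0.
  apply/eqP; rewrite eq_le; apply/andP; split; last first.
    by apply: Rintegral_ge0 => x _; exact: sqr_ge0.
  apply: le_trans h; rewrite /H1sq (bigD1 None)//= lerDl;
    apply: sumr_ge0 => o _.
  by apply: Rintegral_ge0 => x _; exact: sqr_ge0.
have := sqint0_ae mU (H1_sqint oU hd1) i0'.
by apply: filterS => x hx Ux; have /= := hx Ux; lra.
Qed.

Lemma variational_exists G : (forall o, sqint vol U (G o)) ->
  exists v, H10 U v /\ forall p, H10 U p -> energy v p = jetform U G p.
Proof.
move=> sG.
have [C C0 hC] := energy_coercive; have [D D0 hD] := jetform_bound oU sG.
pose lc (a b : R) u w : Rn -> R := fun x => a * u x + b * w x.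
have tH1 p : test_function U p -> H1 U p by exact: test_H1.
have tH10 p : test_function U p -> H10 U p by exact: test_H10.
have DC0 : 0 <= D * C by exact: mulr_ge0.
have Blc a b u w v : test_function U u -> test_function U w -> test_function U
  v ->
    energy (lc a b u w) v = a * energy u v + b * energy w v.
  by move=> /tH1 hu /tH1 hw /tH1 hv; exact: energy_lin.
have B0 u : test_function U u -> 0 <= energy u u.
  move=> /tH1 hu; apply: le_trans (energy_ge hu).
  apply: mulr_ge0; first exact: ltW.
  by apply: sumr_ge0 => i _; apply: Rintegral_ge0 => x _; exact: sqr_ge0.
have Llc a b u w : test_function U u -> test_function U w ->
    jetform U G (lc a b u w) = a * jetform U G u + b * jetform U G w.
  by move=> /tH1 hu /tH1 hw; exact: jetform_lin.
(* [D] bounds the functional in the H^1 norm and [C] passes from that norm to the energy. *)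
have LB u : test_function U u -> jetform U G u ^+ 2 <= D * C * energy u u.
  move=> tu; apply: le_trans (hD _ (tH1 _ tu)) _.
  by rewrite -mulrA; apply: ler_wpM2l => //; exact: hC (tH10 _ tu).
have [x [tx cx wx]] := @riesz_sequence R (Rn -> R) lc (test_function U) (cst 0)
  energy (jetform U G) (D * C) DC0 (test0 U) (fun a b u w =>
    @test_lin _ _ U u w a b)
  Blc (fun u w _ _ => energyC u w) B0 Llc LB.
have hx k : H1 U (x k) by exact: tH1.
have cj o e : 0 < e -> exists N, forall k l, (N <= k)%N -> (N <= l)%N ->
    \int[vol]_(y in U) ((jet U (x k) o y - jet U (x l) o y) ^+ 2) <= e.
  move=> e0.
  have [|N hN] := cx (e / (C + 1)); first by rewrite divr_gt0// ltr_wpDl.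
  exists N => k l Nk Nl; have hl := test_lin 1 (-1) (tx k) (tx l).
  have hl1 := tH1 _ hl.
  apply: (@le_trans _ _ (H1sq U (lc 1 (-1) (x k) (x l)))); last first.
    apply: le_trans (hC _ (tH10 _ hl)) _.
    apply: le_trans (ler_wpM2l C0 (hN k l Nk Nl)) _.
    by rewrite mulrA ler_pdivrMr ?ltr_wpDl// [leLHS]mulrC ler_pM2l// lerDl
      ler01.
  apply: (@le_trans _ _ (\int[vol]_(y in U) (jet U (lc 1 (-1) (x k) (x l)) o y
    ^+ 2))).
    rewrite le_eqVlt; apply/orP; left; apply/eqP; apply: ae_eq_Rintegral => //.
    - apply: measurable_funX; apply: measurable_funB.
        exact: (jet_sqint o oU (hx k)).1.
      exact: (jet_sqint o oU (hx l)).1.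
    - by apply: measurable_funX; exact: (jet_sqint o oU hl1).1.
    - have := jet_lin 1 (-1) o oU (hx k) (hx l); apply: filterS => y h Uy.
      by rewrite h// mul1r mulN1r.
  rewrite /H1sq [leRHS](bigD1 o)//= lerDl; apply: sumr_ge0 => o' _.
  by apply: Rintegral_ge0 => y _; exact: sqr_ge0.
have [g hg] : {g : option 'I_n -> Rn -> R & forall o, sqint vol U (g o) /\
    (forall e, 0 < e -> exists N, forall k, (N <= k)%N ->
     \int[vol]_(y in U) ((g o y - jet U (x k) o y) ^+ 2) <= e)}.
  apply: (@choice _ _ (fun o g => sqint vol U g /\
    (forall e, 0 < e -> exists N, forall k, (N <= k)%N ->
     \int[vol]_(y in U) ((g y - jet U (x k) o y) ^+ 2) <= e))) => o.
  by have [g sg cg] := riesz_fischer mU (fun k =>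
    jet_sqint o oU (hx k)) (cj o); exists g.
pose v := g None.
have gcvg o h : sqint vol U h -> \int[vol]_(y in U) (h y * jet U (x k) o y)
  @[k --> \oo] -->
    \int[vol]_(y in U) (h y * g o y).
  move=> sh; have [sg cg] := hg o.
  exact: (sqint_cvg_pairing mU (fun k => jet_sqint o oU (hx k)) sg sh cg).
(* Each side of the defining identity for [x k] pairs its jet with a fixed L^2 function, [q] or a
   derivative of [q], so both sides converge. *)
have dv i : weak_partial U i v (g (Some i)).
  split; [exact: sqint_L1loc (hg None).1|exact: sqint_L1loc (hg (Some i)).1|].
  move=> q tq; have sq := test_sqint oU tq;
    have sdq := test_sqint oU (test_partial i tq).
  have c1 := gcvg None _ sdq; have c2 := gcvg (Some i) _ sq.
  under eq_Rintegral do rewrite mulrC.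
  under [in RHS]eq_Rintegral do rewrite mulrC.
  have c3 : - (\int[vol]_(y in U) (q y * jet U (x k) (Some i) y)) @[k --> \oo]
    -->
      - (\int[vol]_(y in U) (q y * g (Some i) y)) by exact: cvgN.
  suff E : (fun k => \int[vol]_(y in U) (partial i q y * jet U (x k) None y)) =
    (fun k => - \int[vol]_(y in U) (q y * jet U (x k) (Some i) y)).
    by move: c1; rewrite E => /cvg_lim <- //; move/cvg_lim: c3 => <- //.
  apply/funext => k; have [_ _ /(_ q tq)] := H1_wpartial i oU (hx k).
  under eq_Rintegral do rewrite mulrC.
  by under [in X in _ = X -> _]eq_Rintegral do rewrite mulrC.
have hv : H1 U v.
  apply: (@H1_intro _ _ _ _ (fun i => g (Some i))) => //;
    first exact: (hg None).1.
  by move=> i; split; [exact: dv|exact: (hg (Some i)).1].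
have jv o : ae_eq vol U (jet U v o) (g o).
  by case: o => [i|]; [exact: wpartial_ae|exact: ae_eq_refl].
have hv10 : H10 U v.
  apply/(H10P oU hv) => e e0.
  (* [c] counts the [n + 1] components of a jet: each gets the share [e / c], and as they are
     finitely many one index serves them all. *)
  pose c : R := #|{: option 'I_n}|%:R.
  have c0 : 0 < c by rewrite ltr0n; apply/card_gt0P; exists None.
  have [N _ hN] : \forall k \near \oo, forall o,
      \int[vol]_(y in U) ((g o y - jet U (x k) o y) ^+ 2) <= e / c.
    apply: filter_forall => o; have [|N hN] := (hg o).2 (e / c);
      first exact: divr_gt0.
    by exists N.
  exists (x N) => //; have {}hN := hN N (leqnn N).
  have hl := H1_lin 1 (-1) oU hv (hx N).
  rewrite (_ : (fun y => _) = (fun y => 1 * v y + (-1) * x N y)); last first.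
    by apply/funext => y; rewrite mul1r mulN1r.
  apply: (@le_trans _ _ (\sum_(o : option 'I_n) e / c)); last first.
    by rewrite sumr_const -mulr_natr divfK// gt_eqF.
  apply: ler_sum => o _; apply: le_trans (hN o).
  rewrite le_eqVlt; apply/orP; left; apply/eqP; apply: ae_eq_Rintegral => //.
  - by apply: measurable_funX; exact: (jet_sqint o oU hl).1.
  - apply: measurable_funX; apply: measurable_funB; first exact: (hg o).1.1.
    exact: (jet_sqint o oU (hx N)).1.
  - have := jv o; have := jet_lin 1 (-1) o oU hv (hx N);
    apply: filterS2 => y h1 h2 Uy.
    by rewrite h1// h2// mul1r mulN1r.
(* By symmetry, the energy of [x k] against [p] pairs the jet of [x k] with the fixed L^2
   coefficients [flux p], so it tends to the energy of [v] against [p] as well as to the functional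
   at [p]. *)
have tv p : test_function U p -> energy v p = jetform U G p.
  move=> tp; have hp := tH1 _ tp; rewrite energyC energyE//.
  have E : (fun k => energy (x k) p) = (fun k => jetform U (flux p) (x k)).
    by apply/funext => k; rewrite energyC energyE.
  have -> : jetform U (flux p) v = \sum_o \int[vol]_(y in U) (flux p o y * g o
    y).
    apply: eq_bigr => o _; apply: ae_eq_Rintegral => //.
    - by apply: measurable_funM; [exact: (flux_sqint o hp).1|exact: (jet_sqint
      o oU hv).1].
    - by apply: measurable_funM; [exact: (flux_sqint o hp).1|exact: (hg o).1.1].
    - by have := jv o; apply: filterS => y h Uy; rewrite h.
  have c : jetform U (flux p) (x k) @[k --> \oo] -->
      \sum_o \int[vol]_(y in U) (flux p o y * g o y).
    rewrite (_ : (fun k => _) = \sum_o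
        (fun k => \int[vol]_(y in U) (flux p o y * jet U (x k) o y)));
          last first.
      by apply/funext => k; rewrite fct_sumE.
    apply: (big_ind2 (fun (f : nat -> R) (c : R) => f k @[k --> \oo] --> c)).
    - exact: cvg_cst.
    - by move=> f1 c1 f2 c2 h1 h2; exact: cvgD.
    - by move=> o _; apply: gcvg; exact: flux_sqint.
  by have := wx p tp; rewrite E => /cvg_lim <- //; move/cvg_lim: c => <- //.
exists v; split => // p hp; have hp1 := H10_H1 hp.
(* The difference of both sides is again a [jetform] with L^2 coefficients, zero on test functions,
   so density extends the equation to H^1_0. *)
rewrite energyE//; apply/eqP; rewrite -subr_eq0; apply/eqP.
have fv o : sqint vol U (flux v o) by exact: flux_sqint.
have -> : jetform U (flux v) p - jetform U G p =
    jetform U (fun o x => 1 * flux v o x + (-1) * G o x) p.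
  by rewrite jetform_linG// mul1r mulN1r.
apply: (jetform_density oU _ _ hp); first by move=> o; exact: sqint_lin.
move=> q tq.
have hq := tH1 _ tq.
by rewrite (@jetform_linG (flux v) G)// -energyE// tv// mul1r mulN1r subrr.
Qed.

End variational_problem.

(** * The interface problem *)

Section product_weak_partial.
Context {R : realType} {n : nat}.
Local Notation Rn := 'rV[R]_n.
Local Notation vol := (lebesgue_rV R n).
Implicit Types (b p q : Rn -> R).

Lemma within_closure_continuous (W : set Rn) (f : Rn -> R) : open W ->
  {within closure W, continuous f} -> forall x, W x -> {for x, continuous f}.
Proof.
move=> oW cf x Wx.
have : {within W, continuous f} by apply: continuous_subspaceW cf;
  exact: subset_closure.
by rewrite continuous_open_subspace// => /(_ x (mem_set Wx)).
Qed.

Variables (U W : set Rn) (i : 'I_n) (f h : Rn -> R).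
Hypothesis oU : open U.
Hypothesis bU : bounded_set U.
Hypothesis oW : open W.
Hypothesis WU : W `<=` U.
Hypothesis cf : {within closure W, continuous f}.
Hypothesis ch : {within closure W, continuous h}.
Hypothesis dfh : forall x, W x -> is_derive x (std_basis i) f (h x).

Let mU : measurable U := open_measurable_rV oU.
Let mW : measurable W := open_measurable_rV oW.

Lemma bounded_within (g : Rn -> R) : {within closure W, continuous g} ->
  measurable_fun W g /\ exists M, forall x, W x -> `|g x| <= M.
Proof.
move=> cg; split.
  by apply: open_continuous_measurable_rV => //;
    exact: within_closure_continuous.
have bW : bounded_set W by have [M [Mr hM]] := bU; exists M;
  split => // s Ms x /WU; exact: hM.
have [M hM] := compact_continuous_bounded (compact_closure_bounded bW) cg.
by exists M => x Wx; apply: hM; exact: subset_closure.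
Qed.

Definition dprod b p x : R :=
  wpartial U i b x * p x * f x + b x * wpartial U i p x * f x + b x * p x * h x.

Let integrable_prod b p g : {within closure W, continuous g} ->
  sqint vol U b -> sqint vol U p ->
  vol.-integrable W (EFin \o (fun x => b x * p x * g x)).
Proof.
move=> cg sb sp; have [mg [M hM]] := bounded_within cg.
apply: (integrable_mul_bounded mW _ mg hM).
exact: integrableS (sqintM mU sb sp).
Qed.

Lemma dprod_integrable b p : H10 U b -> H10 U p ->
  vol.-integrable W (EFin \o dprod b p).
Proof.
move=> /H10_H1 hb /H10_H1 hp.
have i1 := integrable_prod cf (H1_wpartial_sqint i oU hb) (H1_sqint oU hp).
have i2 := integrable_prod cf (H1_sqint oU hb) (H1_wpartial_sqint i oU hp).
have i3 := integrable_prod ch (H1_sqint oU hb) (H1_sqint oU hp).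
exact: (integrableD mW (integrableD mW i1 i2) i3).
Qed.

(* For a test function [q] on [W], this is [ibp_H10] on [U] with the weight
   [f q]: the values of [f] outside [W] are arbitrary but multiplied by [0], so
   the weight is C^1 in direction [i] on the whole space. *)
Lemma weak_partial_prod b p : H10 U b -> H10 U p ->
  weak_partial W i (fun x => b x * p x * f x) (dprod b p).
Proof.
move=> hb hp; have [hb1 hp1] := (H10_H1 hb, H10_H1 hp).
have iu := integrable_prod cf (H1_sqint oU hb1) (H1_sqint oU hp1).
have id := dprod_integrable hb hp.
have l1 : L1loc W (fun x => b x * p x * f x).
  by move=> K cK KW; apply: integrableS iu => //; exact: compact_measurable_rV.
have l2 : L1loc W (dprod b p).
  by move=> K cK KW; apply: integrableS id => //; exact: compact_measurable_rV.
split => // q tq.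
have [K [cK KW q0]] := tq.2.
have dq0 x : ~ K x -> partial i q x = 0 by exact: partial_out.
have cq := test_continuous tq; have cdq := test_continuous (test_partial i tq).
(* [K] is closed, so off [K] the functions [rho] and [drho] vanish in a whole neighbourhood;
   continuity and derivability there do not depend on [f] and [h]. *)
have oK x : ~ K x -> nbhs x (~` K).
  by move=> nK; apply: open_nbhs_nbhs; split => //; apply: closed_openC;
    exact: closed_compact_rV.
pose rho x := f x * q x.
pose drho x := h x * q x + f x * partial i q x.
have cfx := within_closure_continuous oW cf;
  have chx := within_closure_continuous oW ch.
have crho : continuous rho.
  move=> x; have [Kx|nKx] := pselect (K x).
    by apply: continuousM; [exact: cfx (KW _ Kx)|exact: cq].
  rewrite /continuous_at {2}/rho q0// mulr0;
    apply: (@cvg_near_cst _ _ _ _ (nbhs x) (nbhs_filter x)).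
  by apply: filterS (oK x nKx) => y nKy; rewrite /rho q0// mulr0.
have cdrho : continuous drho.
  move=> x; have [Kx|nKx] := pselect (K x).
    apply: (@continuousD _ _ _ (fun x => h x * q x) (fun x =>
      f x * partial i q x));
      apply: continuousM; [exact: chx (KW _ Kx)|exact: cq|exact: cfx (KW _
        Kx)|exact: cdq].
  rewrite /continuous_at {2}/drho q0// dq0// !mulr0 addr0.
  apply: (@cvg_near_cst _ _ _ _ (nbhs x) (nbhs_filter x));
    apply: filterS (oK x nKx) => y nKy.
  by rewrite /drho q0// dq0// !mulr0 addr0.
have drhoP x : is_derive x (std_basis i) rho (drho x).
  have [Kx|nKx] := pselect (K x).
    apply: (is_derive_eq (is_deriveM (dfh (KW _ Kx)) (smooth_derive i x tq.1))).
    by rewrite /drho /GRing.scale /= addrC mulrC.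
  rewrite /drho q0// dq0// !mulr0 addr0;
    apply: (@near_eq_is_derive _ _ _ (cst 0)).
  by apply: filterS (oK x nKx) => y nKy; rewrite /rho q0// mulr0.
have := ibp_H10 oU bU crho cdrho drhoP hb hp.
rewrite (@Rintegral_support _ _ _ _ U W)//; last first.
  move=> x Ux nWx; have nKx : ~ K x by move=> /KW.
  by rewrite /rho /drho q0// dq0//; ring.
move=> E; apply/eqP; rewrite -addr_eq0; apply/eqP; rewrite -RintegralD//.
- by rewrite -[RHS]E; apply: eq_Rintegral => x _; rewrite /rho /drho /dprod;
  ring.
- by apply: L1loc_test => //; exact: test_partial.
- exact: L1loc_test.
Qed.

End product_weak_partial.

(** * The right-hand side as functionals with L^2 coefficients *)

Section interface_problem.
Context {R : realType} {n : nat}.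
Local Notation Rn := 'rV[R]_n.
Local Notation vol := (lebesgue_rV R n).
Variables (U : set Rn) (phi : Rn -> R).
Hypothesis oU : open U.
Hypothesis bU : bounded_set U.
Hypothesis interfaceP : level_set_interface U phi.

Let mU : measurable U := open_measurable_rV oU.

Let phi_continuous x : U x -> {for x, continuous phi}.
Proof. by move=> Ux; have [sphi _ _ _] := interfaceP;
  have [] := sphi [::] x Ux. Qed.

Lemma open_region_neg : open (region_neg U phi).
Proof.
rewrite openE => x [Ux /= px]; apply: filterI; first exact: open_nbhs_nbhs.
have h : nbhs (phi x) [set y : R | y < 0].
  by apply: open_nbhs_nbhs; split => //; exact: open_lt.
exact: (phi_continuous Ux h).
Qed.

Lemma open_region_pos : open (region_pos U phi).
Proof.
rewrite openE => x [Ux /= px]; apply: filterI; first exact: open_nbhs_nbhs.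
have h : nbhs (phi x) [set y : R | 0 < y].
  by apply: open_nbhs_nbhs; split => //; exact: open_gt.
exact: (phi_continuous Ux h).
Qed.

Let mneg : measurable (region_neg U phi) := open_measurable_rV open_region_neg.
Let mpos : measurable (region_pos U phi) := open_measurable_rV open_region_pos.
Let nU : region_neg U phi `<=` U. Proof. by move=> x []. Qed.
Let pU : region_pos U phi `<=` U. Proof. by move=> x []. Qed.

Lemma bounded_subset (A : set Rn) : A `<=` U -> bounded_set A.
Proof.
by move=> AU; have [M [Mr hM]] := bU; exists M; split => // s Ms x /AU;
  exact: hM.
Qed.

(** Points with [phi x = 0] lie in the frontier of Omega^-. Thus a piecewise C^1 coefficient,
    continuous up to the boundary of Omega^-, is measurable and bounded on the interface too. *)
Lemma region_nonpos_closure :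
  U `\` region_pos U phi `<=` closure (region_neg U phi).
Proof.
move=> x [Ux npx]; have [px|px|px] := ltgtP (phi x) 0.
- by apply: subset_closure; split.
- by exfalso; apply: npx; split.
- have [_ _ _ fE] := interfaceP.
  have : frontier (region_neg U phi) x by rewrite fE; split.
  by case.
Qed.

Lemma piecewise_C1_bounded (f : Rn -> R) : piecewise_C1 U phi f ->
  measurable_fun U f /\ exists M, forall x, U x -> `|f x| <= M.
Proof.
move=> [[cf _] [h [[ch _] fh]]].
have mD : measurable (U `\` region_pos U phi) by exact: measurableD.
have UE : U = (U `\` region_pos U phi) `|` region_pos U phi by rewrite setUC
  setDUK.
split.
  rewrite UE; apply/(measurable_funU _ mD mpos); split.
    apply: (measurable_funS _ region_nonpos_closure).
      by apply: closed_measurable_rV; exact: closed_closure.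
    by apply: closed_continuous_measurable_rV => //; exact: closed_closure.
  apply: (@eq_measurable_fun _ _ _ _ _ h).
    by move=> x; rewrite inE => px; rewrite fh.
  apply: (@measurable_funS _ _ _ _ (closure (region_pos U phi))).
  - by apply: closed_measurable_rV; exact: closed_closure.
  - exact: subset_closure.
  - by apply: closed_continuous_measurable_rV => //; exact: closed_closure.
have [M hM] := compact_continuous_bounded (compact_closure_bounded
  (bounded_subset nU)) cf.
have [N hN] := compact_continuous_bounded (compact_closure_bounded
  (bounded_subset pU)) ch.
exists (Num.max M N) => x Ux; rewrite le_max.
have [px|npx] := pselect (region_pos U phi x).
  by rewrite fh// hN ?orbT//; exact: subset_closure.
by rewrite hM//; apply: region_nonpos_closure.
Qed.

Lemma sqint_neg_region (f g : Rn -> R) (M : R) : sqint vol U f ->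
  measurable_fun (region_neg U phi) g ->
  (forall x, region_neg U phi x -> `|g x| <= M) ->
  sqint vol U (fun x => f x * (g \_ (region_neg U phi)) x).
Proof.
move=> sf mg hg; apply: (@sqint_bounded _ _ _ _ _ _ _ (Num.max M 0)) => //.
  by apply/(measurable_restrict _ mneg mU);
    apply: measurable_funS mg => // x [].
move=> x _; rewrite patchE le_max; case: ifPn => [|_];
  first by rewrite inE => /hg ->.
by rewrite normr0 lexx orbT.
Qed.

Lemma Rintegral_neg_region (f : Rn -> R) :
  \int[vol]_(x in region_neg U phi) f x =
  \int[vol]_(x in U) (f x * ((cst 1 : Rn -> R) \_ (region_neg U phi)) x).
Proof.
rewrite (@Rintegral_support _ _ _ _ U (region_neg U phi))//.
  by apply: eq_Rintegral => x xn; rewrite patchE xn mulr1.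
by move=> x _ nx; rewrite patchE memNset// mulr0.
Qed.

Section normal.
Variables (nu : Rn -> Rn) (b : Rn -> R).
Hypothesis nuP : normal_extension U phi nu.
Hypothesis hb : H10 U b.

(** The product rule for [b p nu_i], summed over [i], has [p] multiplied by the sum of
    [d_i b nu_i + b h_i], where [h_i] continuously extends [d_i nu_i], and [d_i p] multiplied by
    [b nu_i]. Cut off outside Omega^-, these are the L^2 coefficients; uniqueness of weak
    derivatives identifies the chosen divergence with this sum a.e. *)
Lemma surface_term : exists G : option 'I_n -> Rn -> R,
  (forall o, sqint vol U (G o)) /\
  forall p, H10 U p -> \int[vol]_(x in region_neg U phi)
     wdiv (region_neg U phi) (fun y => (b y * p y) *: nu y) x = jetform U G p.
Proof.
pose W := region_neg U phi; have oW : open W := open_region_neg.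
pose f (i : 'I_n) (x : Rn) : R := nu x ord0 i.
have cf i : {within closure W, continuous (f i)} by have [] := nuP.1 i.
have [h hh] : {h : 'I_n -> Rn -> R & forall i, {within closure W,
  continuous (h i)} /\
    forall x, W x -> is_derive x (std_basis i : Rn) (f i) (h i x)}.
  apply: (@choice _ _ (fun i h => {within closure W, continuous h} /\
    forall x, W x -> is_derive x (std_basis i : Rn) (f i) (h x))) => i.
  have [_ /(_ i)[dn [h [ch he]]]] := nuP.1 i.
  by exists h; split => // x Wx; apply: DeriveDef; [exact: dn|rewrite he].
have hb1 := H10_H1 hb.
pose G o x := if o is Some i then b x * (f i \_ W) x else
  \sum_i (wpartial U i b x * (f i \_ W) x + b x * (h i \_ W) x).
have sf i u : sqint vol U u -> sqint vol U (fun x => u x * (f i \_ W) x).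
  move=> su; have [mf [M hM]] := bounded_within bU oW nU (cf i).
  exact: sqint_neg_region su mf hM.
have sh i u : sqint vol U u -> sqint vol U (fun x => u x * (h i \_ W) x).
  move=> su; have [mh [M hM]] := bounded_within bU oW nU (hh i).1.
  exact: sqint_neg_region su mh hM.
have sG o : sqint vol U (G o).
  case: o => [i|]; first by apply: sf; exact: H1_sqint.
  rewrite /G (_ : (fun x => _) = \sum_i (fun x =>
      wpartial U i b x * (f i \_ W) x + b x * (h i \_ W) x)); last first.
    by apply/funext => x; rewrite fct_sumE.
  elim/big_ind : _ => [|u w su sw|i _].
  - exact: sqint0.
  - exact: sqintD.
  - by apply: sqintD => //; [apply: sf; exact: H1_wpartial_sqint|apply: sh;
    exact: H1_sqint].
exists G; split => // p hp; have hp1 := H10_H1 hp.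
have wp i := weak_partial_prod oU bU oW nU (cf i) (hh i).1 (hh i).2 hb hp.
have id i : vol.-integrable W (EFin \o dprod U i (f i) (h i) b p).
  exact: (dprod_integrable i oU bU oW nU (cf i) (hh i).1 hb hp).
have e1 : \int[vol]_(x in W) wdiv W (fun y => (b y * p y) *: nu y) x =
    \int[vol]_(x in W) (\sum_i dprod U i (f i) (h i) b p x).
  apply: ae_eq_Rintegral => //.
  - rewrite /wdiv; apply: measurable_sum => i.
    rewrite (_ : (fun y => _) = (fun y => b y * p y * f i y)); last first.
      by apply/funext => y; rewrite mxE.
    by apply: L1loc_measurable => //; have [] := wpartialP (wp i).
  - by apply: measurable_sum => i; apply/measurable_EFinP;
    exact: (measurable_int vol (id i)).
  - have : {ae vol, forall x, forall i : 'I_n, W x ->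
        wpartial W i (fun y => b y * p y * f i y) x = dprod U i (f i) (h i) b
          p x}.
      by apply: filter_forall => i; exact: wpartial_ae oW (wp i).
    apply: filterS => x hx Wx; rewrite /wdiv; apply: eq_bigr => i _.
    rewrite -hx//; congr (wpartial _ _ _ _).
    by apply/funext => y; rewrite mxE.
rewrite e1 Rintegral_neg_region /jetform.
have [_ <-] := @Rintegral_sum _ _ _ U (index_enum (option 'I_n))
  (fun o x => G o x * jet U p o x) mU
  (fun o => sqintM mU (sG o) (jet_sqint o oU hp1)).
apply: eq_Rintegral => x _; rewrite big_option /= !mulr_suml -big_split /=.
apply: eq_bigr => i _; rewrite !patchE; case: ifPn => _; rewrite /dprod;
  last first.
  (* Outside Omega^- the restricted functions take the default value [point], which is 0 in [R]. *)
  by rewrite -[point]/(0 : R); ring.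
by rewrite /f /=; ring.
Qed.

End normal.

Lemma source_term (f : Rn -> R) : sqint vol U f ->
  exists G : option 'I_n -> Rn -> R, (forall o, sqint vol U (G o)) /\
  forall p, \int[vol]_(x in U) (f x * p x) = jetform U G p.
Proof.
move=> sf; exists (fun o => if o is Some _ then cst 0 else f); split.
  by case=> [i|] //; exact: sqint0.
move=> p; rewrite /jetform big_option big1 ?addr0// => i _.
by under eq_Rintegral do rewrite mul0r; rewrite Rintegral_cst// mul0r.
Qed.

Lemma neg_region_term (beta : Rn -> 'M[R]_n) (K : 'I_n -> 'I_n -> R)
    (a : Rn -> R) :
  (forall i j, measurable_fun U (fun x => beta x i j)) ->
  (forall i j x, U x -> `|beta x i j| <= K i j) -> H1 U a ->
  exists G : option 'I_n -> Rn -> R, (forall o, sqint vol U (G o)) /\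
  forall p, H1 U p -> \int[vol]_(x in region_neg U phi)
    dot (mulmxv (beta x) (wgrad U a x)) (wgrad U p x) = jetform U G p.
Proof.
move=> mb Kb ha.
have sfl o : sqint vol U (flux U beta a o) := flux_sqint oU mb Kb o ha.
pose G o x := flux U beta a o x * ((cst 1 : Rn -> R) \_ (region_neg U phi)) x.
have sG o : sqint vol U (G o).
  by apply: (@sqint_neg_region _ (cst 1) 1) => // x _; rewrite normr1.
exists G; split => // p hp; rewrite Rintegral_neg_region /jetform.
have [_ <-] := @Rintegral_sum _ _ _ U (index_enum (option 'I_n))
  (fun o x => G o x * jet U p o x) mU
  (fun o => sqintM mU (sG o) (jet_sqint o oU hp)).
apply: eq_Rintegral => x _; rewrite big_option /= /G /= !mul0r add0r /dot
  mulr_suml.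
apply: eq_bigr => i _; rewrite !mxE mulrAC; congr (_ * _ * _).
by apply: eq_bigr => j _; rewrite !mxE.
Qed.

End interface_problem.

Theorem theorem2p2 (R : realType) (n : nat) (n_gt0 : (0 < n)%N)
  (Om : set 'rV[R]_n) (phi : 'rV[R]_n -> R)
  (beta : 'rV[R]_n -> 'M[R]_n) (m M : R)
  (nu : 'rV[R]_n -> 'rV[R]_n) (f g a b : 'rV[R]_n -> R)
  (Om_domain : bounded_smooth_domain Om)
  (Gamma_interface : level_set_interface Om phi)
  (beta_sym : forall x, Om x -> (beta x)^T = beta x)
  (beta_pos : forall x, Om x -> forall xi : 'rV[R]_n, xi != 0 ->
    0 < dot (mulmxv (beta x) xi) xi)
  (beta_C1 : forall i j, piecewise_C1 Om phi (fun x => beta x i j))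
  (m_gt0 : 0 < m) (m_lt_M : m < M)
  (beta_bounds : loewner_bounds Om beta m M)
  (nu_normal : normal_extension Om phi nu)
  (f_L2 : L2 Om f) (g_H1 : H1 Om g) (a_H10 : H10 Om a) (b_H10 : H10 Om b) :
  exists u : 'rV[R]_n -> R,
    [/\ Hag Om phi a g u,
        weak_equation Om phi beta nu f g a b (jump_lift Om phi a g u) &
        forall u' : 'rV[R]_n -> R, Hag Om phi a g u' ->
          weak_equation Om phi beta nu f g a b (jump_lift Om phi a g u') ->
          {ae lebesgue_rV R n, forall x, Om x -> u' x = u x}].
Proof.
have [oU _ _ bU _] := Om_domain; have mU := open_measurable_rV oU.
(* Any direction would do for the Poincare inequality; a positive dimension provides one. *)
pose i0 := Ordinal n_gt0.
have bmeas i j : measurable_fun Om (fun x => beta x i j).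
  by have [] := piecewise_C1_bounded oU bU Gamma_interface (beta_C1 i j).
have [K0 hK0] : {K : 'I_n * 'I_n -> R & forall ij x,
  Om x -> `|beta x ij.1 ij.2| <= K ij}.
  apply: (@choice _ _ (fun (ij : 'I_n * 'I_n) (K : R) =>
    forall x, Om x -> `|beta x ij.1 ij.2| <= K)) => -[i j].
  by have [] := piecewise_C1_bounded oU bU Gamma_interface (beta_C1 i j).
pose K i j := K0 (i, j).
have hK i j x : Om x -> `|beta x i j| <= K i j by exact: (hK0 (i, j)).
have bell x : Om x -> forall xi : 'rV[R]_n,
  m * dot xi xi <= dot (mulmxv (beta x) xi) xi.
  by move=> Ux xi; have [] := beta_bounds x Ux xi.
have [Gb [sGb hGb]] := surface_term oU bU Gamma_interface nu_normal b_H10.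
have [Ga [sGa hGa]] :=
  neg_region_term oU Gamma_interface bmeas hK (H10_H1 a_H10).
have [F0 [sF0 hF0]] := source_term oU ((L2P _ mU).1 f_L2).
have sfl o := flux_sqint oU bmeas hK o g_H1.
pose G1 o x := 1 * F0 o x + 1 * flux Om beta g o x.
pose G2 o x := 1 * Ga o x + (-1) * Gb o x.
(* The equation carries a minus sign before the energy, so [G] collects the opposite of its
   right-hand side: source and [g] terms negated, [a] term positive, [b] term negative. *)
pose G o x := (-1) * G1 o x + 1 * G2 o x.
have sG1 o : sqint (lebesgue_rV R n) Om (G1 o) by exact: sqint_lin.
have sG2 o : sqint (lebesgue_rV R n) Om (G2 o) by exact: sqint_lin.
have sG o : sqint (lebesgue_rV R n) Om (G o) by exact: sqint_lin.
have weakP v : weak_equation Om phi beta nu f g a b v <->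
    forall p, H10 Om p -> energy Om beta v p = jetform Om G p.
  have rhs p : H10 Om p -> jetform Om G p = - (
    (\int[lebesgue_rV R n]_(x in Om) (f x * p x))
    + (\int[lebesgue_rV R n]_(x in Om) dot (mulmxv (beta x) (wgrad Om g x))
      (wgrad Om p x))
    - (\int[lebesgue_rV R n]_(x in region_neg Om phi)
         dot (mulmxv (beta x) (wgrad Om a x)) (wgrad Om p x))
    + (\int[lebesgue_rV R n]_(x in region_neg Om phi)
         wdiv (region_neg Om phi) (fun y => (b y * p y) *: nu y) x)).
    move=> hp; have hp1 := H10_H1 hp.
    rewrite (jetform_linG oU _ _ sG1 sG2 hp1) (jetform_linG oU _ _ sF0 sfl hp1).
    rewrite (jetform_linG oU _ _ sGa sGb hp1) -(hF0 p) -(hGa p hp1) -(hGb p hp).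
    rewrite -(energyE oU bmeas hK g_H1 hp1).
    have arith (x y z w : R) :
      -1 * (1 * x + 1 * y) + 1 * (1 * z + -1 * w) = - (x + y - z + w) by ring.
    exact: arith.
  split=> E p hp; first by rewrite (rhs p hp) -(E p hp) opprK.
  by have := E p hp; rewrite (rhs p hp) /energy => ->; rewrite opprK.
have [v [hv ve]] := variational_exists i0 oU bU bmeas hK beta_sym m_gt0 bell sG.
pose u x := v x + g x - a x * \1_(region_neg Om phi) x.
have ju : jump_lift Om phi a g u = v by apply/funext => x;
  rewrite /jump_lift /u; ring.
exists u; split.
- by rewrite /Hag ju.
- by rewrite ju; apply/weakP.
- move=> u' hu' /weakP eu'.
  have := variational_unique i0 oU bU bmeas hK beta_sym m_gt0 bell hu' hv.
  move=> /(_ (fun p hp => etrans (eu' p hp) (esym (ve p hp)))).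
  (* The lifts of [u'] and [u] differ from them by the same fixed function, so equality of the lifts
     is equality of the solutions. *)
  by apply: filterS => x h Ux; have := h Ux; rewrite /jump_lift /u; lra.
Qed.
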